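(* Let $\mu$ be a complex number with $2\mu\notin\mathbb{Z}$ and let $x>0$. Then, for either choice of the sign $\pm$ on the left, $$\left.\frac{\partial \mathrm{W}_{\kappa,\pm\mu}(x)}{\partial\kappa}\right|_{\kappa=\mu+1/2}=\sqrt{x}\,e^{-x/2}\left\{x^{\mu}\left[\psi(-2\mu)-\frac{x}{2\mu+1}\,{}_2F_2\left(\left.\begin{array}{c}1,1\\ 2\mu+2,2\end{array}\right|x\right)\right]+\Gamma(2\mu+1)\,x^{-\mu}(-x)^{2\mu}\gamma(-2\mu,-x)\right\}.$$
   Context: For $x>0$ and complex $\kappa,\mu$, the Whittaker function is $\mathrm{W}_{\kappa,\mu}(x)=e^{-x/2}x^{\mu+1/2}\,\mathrm{U}\left(\frac12+\mu-\kappa,1+2\mu,x\right)$, where $\mathrm{U}$ is the Tricomi confluent hypergeometric function. For $2\mu\notin\mathbb{Z}$, equivalently $\mathrm{W}_{\kappa,\mu}(x)=\frac{\Gamma(-2\mu)}{\Gamma(\frac12-\mu-\kappa)}\mathrm{M}_{\kappa,\mu}(x)+\frac{\Gamma(2\mu)}{\Gamma(\frac12+\mu-\kappa)}\mathrm{M}_{\kappa,-\mu}(x)$ with $\mathrm{M}_{\kappa,\mu}(x)=x^{\mu+1/2}e^{-x/2}{}_1F_1\left(\frac12+\mu-\kappa;1+2\mu;x\right)$. The generalized hypergeometric function is ${}_pF_q\left(\left.\begin{array}{c}a_1,\ldots,a_p\\ b_1,\ldots,b_q\end{array}\right|x\right)=\sum_{n\ge0}\frac{(a_1)_n\cdots(a_p)_n}{(b_1)_n\cdots(b_q)_n}\frac{x^n}{n!}$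 with $(\alpha)_n=\Gamma(\alpha+n)/\Gamma(\alpha)$. $\psi=\Gamma'/\Gamma$ is the digamma function. The lower incomplete gamma function is $\gamma(\nu,z)=\int_0^z t^{\nu-1}e^{-t}\,dt$ for $\mathrm{Re}\,\nu>0$, continued analytically in $\nu\neq0,-1,-2,\ldots$ by $\gamma(\nu,z)=\sum_{n\ge0}\frac{(-1)^n z^{\nu+n}}{n!(\nu+n)}$; powers are principal, with $\arg(-x)=\pi$ for $x>0$. *)

(* Defs.v *)
From Stdlib Require Export Reals Factorial List.
From Stdlib Require Import ClassicalEpsilon.
From Coquelicot Require Export Coquelicot.
Open Scope C_scope.

Definition Cexp (z : C) : C := (exp (Re z) * cos (Im z), exp (Re z) * sin (Im z))%R.

(* Principal argument, in (-PI, PI]; a negative real number has argument PI. *)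
Definition Carg (z : C) : R :=
  if Rle_dec 0 (Im z) then acos (Re z / Cmod z) else (- acos (Re z / Cmod z))%R.

Definition Clog (z : C) : C := (ln (Cmod z), Carg z).

Definition Cpower (z w : C) : C := Cexp (w * Clog z).

Definition C_lim_seq (u : nat -> C) : C :=
  (real (Lim_seq (fun n => Re (u n))), real (Lim_seq (fun n => Im (u n)))).

Definition C_series (u : nat -> C) : C :=
  (Series (fun n => Re (u n)), Series (fun n => Im (u n))).

Definition is_Cint (z : C) : Prop := exists k : Z, z = RtoC (IZR k).

(* The rising factorial as a product, so that it is meaningful also at the
   poles of Gamma, where Gamma (a + n) / Gamma a has to be read as a limit. *)
Fixpoint pochhammer (a : C) (n : nat) : C :=
  match n with
  | O => RtoC 1
  | S m => pochhammer a m * (a + RtoC (INR m))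
  end.

(* Euler's limit formula  n! n^z / (z (z+1) ... (z+n)).  As [/ 0 = 0] in [C],
   [Gamma] takes the value 0 at the poles 0, -1, -2, ..., and therefore
   [/ Gamma z] is the entire function 1/Gamma at every complex z. *)
Definition Gamma (z : C) : C :=
  C_lim_seq (fun n =>
    RtoC (INR (fact n)) * Cpower (RtoC (INR n)) z / pochhammer z (S n)).

Definition digamma (z : C) : C := C_derive Gamma z / Gamma z.

Definition Cprod_list (l : list C) : C := fold_right Cmult (RtoC 1) l.

Definition pFq (a b : list C) (z : C) : C :=
  C_series (fun n =>
    Cprod_list (map (fun c => pochhammer c n) a)
    / Cprod_list (map (fun c => pochhammer c n) b)
    * (z ^ n / RtoC (INR (fact n)))).

(* Analytic continuation in nu, for nu different from 0, -1, -2, ...,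
   of the integral of t^(nu-1) e^(-t) over [0, z]. *)
Definition lower_gamma (nu z : C) : C :=
  C_series (fun n =>
    (- RtoC 1) ^ n * Cpower z (nu + RtoC (INR n))
    / (RtoC (INR (fact n)) * (nu + RtoC (INR n)))).

(* Tricomi's function by the connection formula with the two Kummer solutions;
   it has removable singularities at the integers b. *)
Definition TricomiU_connection (a b z : C) : C :=
  Gamma (1 - b) / Gamma (a - b + 1) * pFq (a :: nil) (b :: nil) z
  + Gamma (b - 1) / Gamma a * Cpower z (1 - b)
    * pFq (a - b + 1 :: nil) (2 - b :: nil) z.

Definition TricomiU (a b z : C) : C :=
  if excluded_middle_informative (is_Cint b)
  then C_lim (fun b' => TricomiU_connection a b' z) b
  else TricomiU_connection a b z.

Definition WhittakerW (kappa mu : C) (x : R) : C :=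
  RtoC (exp (- x / 2)) * Cpower (RtoC x) (mu + 1 / 2)
  * TricomiU (1 / 2 + mu - kappa) (1 + 2 * mu) (RtoC x).

(* Main.v *)
From Stdlib Require Import Psatz ClassicalEpsilon.
Require Import Defs.

(** At [kappa = mu + 1/2] the connection formula degenerates: with
    [a = 1/2 + mu - kappa] tending to 0 it reads
    [Gamma(-2mu)/Gamma(a-2mu) 1F1(a;1+2mu;x)
     + Gamma(2mu)/Gamma(a) x^(-2mu) 1F1(a-2mu;1-2mu;x)],
    and [1/Gamma(a)] has a simple zero with derivative 1 at [a = 0].  The product
    rule then yields the digamma term, the 2F2 as the [a]-derivative of the first
    1F1, and [1F1(-2mu;1-2mu;x)], which is a multiple of the incomplete gamma
    series.  The case [-mu] follows from [W_(kappa,-mu) = W_(kappa,mu)].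

    Both [1/Gamma], through Euler's product, and 1F1, as a function of [a], are
    limits of functions whose increments have summable Lipschitz constants, which
    is all that differentiating the limit term by term requires. *)

(** * Limits and derivatives in C *)

(** The reciprocal [RGamma], not [Gamma], is the primary object: the point of differentiation puts
    [Gamma (1/2 + mu - kappa)] exactly at a pole, whereas the entire function [RGamma] passes
    through it with value 0. Since [Gamma] takes the value 0 at its poles and [/ 0 = 0], dividing by
    [Gamma] is multiplying by [RGamma] at every point, the degenerate one included. The same zero
    multiplies the [a]-derivative of the second 1F1, so no closed form of that derivative has to be
    found. The Lipschitz criterion suits the two limits because their increments are explicit. For
    1F1 the increment is a polynomial in [a], controlled by differences of rising factorials. For
    Euler's product it is a partial product times a factor minus 1, which is of order [1/n^2]. *)

Definition is_lim_Cseq (u : nat -> C) (l : C) : Prop :=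
  filterlim u eventually (locally (T := AbsRing_UniformSpace C_AbsRing) l).

(** The uniform structure chosen in [is_lim_Cseq] has the discs of [Cmod] as balls, so both sides
    agree by unfolding. *)
Lemma is_lim_Cseq_spec (u : nat -> C) (l : C) :
  is_lim_Cseq u l <->
  forall eps : R, (0 < eps)%R ->
    exists N : nat, forall n, (N <= n)%nat -> (Cmod (u n - l) < eps)%R.
Proof.
  unfold is_lim_Cseq.
  pose proof (filterlim_locally (F := eventually)
    (U := AbsRing_UniformSpace C_AbsRing) u l) as [H1 H2]; split.
  - intros H eps He; exact (H1 H (mkposreal eps He)).
  - intros H; apply H2; intros eps; exact (H eps (cond_pos eps)).
Qed.

Lemma is_lim_Cseq_ext (u v : nat -> C) (l : C) :
  (forall n, u n = v n) -> is_lim_Cseq u l -> is_lim_Cseq v l.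
Proof. intros H; apply filterlim_ext; exact H. Qed.

Lemma is_lim_Cseq_ext_loc (u v : nat -> C) (l : C) (N : nat) :
  (forall n, (N <= n)%nat -> u n = v n) -> is_lim_Cseq u l -> is_lim_Cseq v l.
Proof. intros H; apply filterlim_ext_loc; exists N; exact H. Qed.

Lemma is_lim_Cseq_const (l : C) : is_lim_Cseq (fun _ => l) l.
Proof. exact (filterlim_const (U := AbsRing_UniformSpace C_AbsRing) l). Qed.

Lemma is_lim_Cseq_plus (u v : nat -> C) (l m : C) :
  is_lim_Cseq u l -> is_lim_Cseq v m -> is_lim_Cseq (fun n => u n + v n) (l + m).
Proof.
  intros Hu Hv.
  exact (filterlim_comp_2 u v Cplus Hu Hv
    (filterlim_plus (V := AbsRing_NormedModule C_AbsRing) l m)).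
Qed.

Lemma is_lim_Cseq_mult (u v : nat -> C) (l m : C) :
  is_lim_Cseq u l -> is_lim_Cseq v m -> is_lim_Cseq (fun n => u n * v n) (l * m).
Proof.
  intros Hu Hv.
  exact (filterlim_comp_2 u v Cmult Hu Hv
    (filterlim_mult (K := C_AbsRing) l m)).
Qed.

Lemma is_lim_Cseq_scal (c : C) (u : nat -> C) (l : C) :
  is_lim_Cseq u l -> is_lim_Cseq (fun n => c * u n) (c * l).
Proof. apply is_lim_Cseq_mult, is_lim_Cseq_const. Qed.

Lemma is_lim_Cseq_minus (u v : nat -> C) (l m : C) :
  is_lim_Cseq u l -> is_lim_Cseq v m -> is_lim_Cseq (fun n => u n - v n) (l - m).
Proof.
  intros Hu Hv.
  replace (l - m) with (l + - (1) * m) by ring.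
  apply (is_lim_Cseq_ext (fun n => u n + - (1) * v n)); [intros n; ring|].
  apply is_lim_Cseq_plus, is_lim_Cseq_scal; assumption.
Qed.

Lemma is_lim_Cseq_unique (u : nat -> C) (l m : C) :
  is_lim_Cseq u l -> is_lim_Cseq u m -> l = m.
Proof.
  exact (filterlim_locally_unique (V := AbsRing_NormedModule C_AbsRing)
    (F := eventually) u l m).
Qed.

Lemma is_lim_Cseq_incr (u : nat -> C) (l : C) :
  is_lim_Cseq (fun n => u (S n)) l <-> is_lim_Cseq u l.
Proof.
  rewrite !is_lim_Cseq_spec; split; intros H eps He;
    destruct (H eps He) as [N HN].
  - exists (S N); intros [|n] Hn; [lia|apply HN; lia].
  - exists N; intros n Hn; apply HN; lia.
Qed.

Lemma Re_minus (a b : C) : Re (a - b) = (Re a - Re b)%R.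
Proof. reflexivity. Qed.

Lemma Im_minus (a b : C) : Im (a - b) = (Im a - Im b)%R.
Proof. reflexivity. Qed.

Lemma im_le_Cmod (z : C) : (Rabs (Im z) <= Cmod z)%R.
Proof. eapply Rle_trans; [apply Rmax_r|apply Rmax_Cmod]. Qed.

Lemma Cmod_le_Re_Im (z : C) : (Cmod z <= Rabs (Re z) + Rabs (Im z))%R.
Proof.
  destruct z as [a b].
  replace (a, b) with (RtoC a + Ci * RtoC b)
    by (unfold RtoC, Ci, Cplus, Cmult; simpl; f_equal; ring).
  eapply Rle_trans; [apply Cmod_triangle|].
  rewrite Cmod_mult, Cmod_Ci, !Cmod_R; unfold Re, Im; simpl.
  right; f_equal; [|rewrite Rmult_1_l]; f_equal; ring.
Qed.

(** [C_lim_seq] and [C_series] are defined coordinatewise, while all estimates are in [Cmod]; this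
    is the bridge. *)
Lemma is_lim_Cseq_Re_Im (u : nat -> C) (l : C) :
  is_lim_Cseq u l <->
  is_lim_seq (fun n => Re (u n)) (Re l) /\ is_lim_seq (fun n => Im (u n)) (Im l).
Proof.
  rewrite is_lim_Cseq_spec, <- !is_lim_seq_spec; split.
  - intros H; split; intros eps; destruct (H eps (cond_pos eps)) as [N HN];
      exists N; intros n Hn; specialize (HN n Hn).
    + rewrite <- Re_minus; eapply Rle_lt_trans; [apply re_le_Cmod|exact HN].
    + rewrite <- Im_minus; eapply Rle_lt_trans; [apply im_le_Cmod|exact HN].
  - intros [H1 H2] eps He.
    destruct (H1 (pos_div_2 (mkposreal eps He))) as [N1 HN1].
    destruct (H2 (pos_div_2 (mkposreal eps He))) as [N2 HN2].
    exists (max N1 N2); intros n Hn.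
    specialize (HN1 n ltac:(lia)); specialize (HN2 n ltac:(lia)); simpl in *.
    eapply Rle_lt_trans; [apply Cmod_le_Re_Im|].
    rewrite Re_minus, Im_minus; lra.
Qed.

Lemma C_lim_seq_unique (u : nat -> C) (l : C) :
  is_lim_Cseq u l -> C_lim_seq u = l.
Proof.
  intros H; apply is_lim_Cseq_Re_Im in H as [H1 H2].
  unfold C_lim_seq.
  rewrite (is_lim_seq_unique _ _ H1), (is_lim_seq_unique _ _ H2).
  destruct l; reflexivity.
Qed.

(** The index [n] is excluded, unlike in [sum_n]: the increment from [n] to [S n] is then exactly
    [u n], and telescoping starts from an empty sum. *)
Fixpoint Cpartial (u : nat -> C) (n : nat) : C :=
  match n with O => 0 | S m => Cpartial u m + u m end.

Lemma Cpartial_ext (u v : nat -> C) (n : nat) :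
  (forall k, u k = v k) -> Cpartial u n = Cpartial v n.
Proof. intros H; induction n as [|n IH]; simpl; [|rewrite IH, H]; reflexivity. Qed.

Lemma Cpartial_scal (c : C) (u : nat -> C) (n : nat) :
  Cpartial (fun k => c * u k) n = c * Cpartial u n.
Proof. induction n as [|n IH]; simpl; [|rewrite IH]; ring. Qed.

Lemma Cpartial_telescope (u : nat -> C) (n : nat) :
  Cpartial (fun k => u (S k) - u k) n = u n - u 0%nat.
Proof. induction n as [|n IH]; cbn [Cpartial]; [|rewrite IH]; ring. Qed.

Lemma Cpartial_Re_Im (u : nat -> C) (n : nat) :
  Re (Cpartial u (S n)) = sum_n (fun k => Re (u k)) n /\
  Im (Cpartial u (S n)) = sum_n (fun k => Im (u k)) n.
Proof.
  induction n as [|n [IH1 IH2]].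
  - rewrite !sum_O; simpl; split; unfold Re, Im; simpl; ring.
  - rewrite !sum_Sn, <- IH1, <- IH2; split; reflexivity.
Qed.

Lemma C_series_unique (u : nat -> C) (l : C) :
  is_lim_Cseq (Cpartial u) l -> C_series u = l.
Proof.
  intros H; apply is_lim_Cseq_incr, is_lim_Cseq_Re_Im in H as [H1 H2].
  unfold C_series.
  rewrite (is_series_unique _ (Re l)), (is_series_unique _ (Im l)).
  - destruct l; reflexivity.
  - refine (is_lim_seq_ext _ _ _ _ H2); intros n; apply Cpartial_Re_Im.
  - refine (is_lim_seq_ext _ _ _ _ H1); intros n; apply Cpartial_Re_Im.
Qed.

Lemma ex_lim_Cpartial (u : nat -> C) (M : nat -> R) :
  ex_series M -> (forall n, (Cmod (u n) <= M n)%R) ->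
  exists l, is_lim_Cseq (Cpartial u) l.
Proof.
  intros HM H.
  destruct (ex_series_le (fun n => Re (u n)) M) as [a Ha]; [|exact HM|].
  { intros n; eapply Rle_trans; [apply re_le_Cmod|apply H]. }
  destruct (ex_series_le (fun n => Im (u n)) M) as [b Hb]; [|exact HM|].
  { intros n; eapply Rle_trans; [apply im_le_Cmod|apply H]. }
  exists (a, b); apply is_lim_Cseq_incr, is_lim_Cseq_Re_Im; split.
  - refine (is_lim_seq_ext (sum_n _) _ (Finite a) _ Ha); intros n; symmetry; apply Cpartial_Re_Im.
  - refine (is_lim_seq_ext (sum_n _) _ (Finite b) _ Hb); intros n; symmetry; apply Cpartial_Re_Im.
Qed.

Lemma Cmod_sub_triangle (a b : C) : (Cmod (a - b) <= Cmod a + Cmod b)%R.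
Proof.
  unfold Cminus; eapply Rle_trans; [apply Cmod_triangle|]; rewrite Cmod_opp; lra.
Qed.

Lemma Cmod_le_lim (u : nat -> C) (l : C) (B : R) (N : nat) :
  is_lim_Cseq u l -> (forall n, (N <= n)%nat -> (Cmod (u n) <= B)%R) ->
  (Cmod l <= B)%R.
Proof.
  intros H HB; apply Rnot_lt_le; intros Hlt.
  destruct (proj1 (is_lim_Cseq_spec u l) H (Cmod l - B)%R ltac:(lra)) as [K HK].
  specialize (HK (max N K) ltac:(lia)); specialize (HB (max N K) ltac:(lia)).
  replace l with (u (max N K) - (u (max N K) - l)) in Hlt at 1 by ring.
  set (v := u (max N K)) in *.
  pose proof (Cmod_sub_triangle v (v - l)).
  replace (v - (v - l)) with l in * by ring; lra.
Qed.

Lemma Cmod_ge_lim (u : nat -> C) (l : C) (B : R) (N : nat) :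
  is_lim_Cseq u l -> (forall n, (N <= n)%nat -> (B <= Cmod (u n))%R) ->
  (B <= Cmod l)%R.
Proof.
  intros H HB; apply Rnot_lt_le; intros Hlt.
  destruct (proj1 (is_lim_Cseq_spec u l) H (B - Cmod l)%R ltac:(lra)) as [K HK].
  specialize (HK (max N K) ltac:(lia)); specialize (HB (max N K) ltac:(lia)).
  set (v := u (max N K)) in *.
  pose proof (Cmod_triangle (v - l) l).
  replace (v - l + l) with v in * by ring; lra.
Qed.

(** * Complex derivatives *)

Definition is_Cderive (f : C -> C) (z l : C) : Prop :=
  is_derive (K := C_AbsRing) (V := C_NormedModule) f z l.

Lemma is_Cderive_spec (f : C -> C) (z l : C) :
  is_Cderive f z l <->
  forall eps : R, (0 < eps)%R -> exists delta : R, (0 < delta)%R /\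
    forall y, (Cmod (y - z) < delta)%R ->
      (Cmod (f y - f z - (y - z) * l) <= eps * Cmod (y - z))%R.
Proof.
  unfold is_Cderive, is_derive, filterdiff; split.
  - intros [_ H] eps He.
    destruct (H z (fun P HP => HP) (mkposreal eps He)) as [d Hd].
    exists d; split; [apply cond_pos|]; intros y Hy.
    exact (Hd y Hy).
  - intros H; split; [apply is_linear_scal_l|].
    intros x Hx.
    apply (is_filter_lim_locally_unique (V := AbsRing_NormedModule C_AbsRing)) in Hx.
    rewrite <- Hx; intros eps.
    destruct (H eps (cond_pos eps)) as [d [Hd0 Hd]].
    exists (mkposreal d Hd0); exact Hd.
Qed.

(** The product and chain rules want C as a module over itself, the theorem wants [C_NormedModule].
    The derivative condition sees the target only through its norm, which is [Cmod] in both
    cases. *)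
Lemma is_Cderive_AbsRing (f : C -> C) (z l : C) :
  is_Cderive f z l <->
  is_derive (K := C_AbsRing) (V := AbsRing_NormedModule C_AbsRing) f z l.
Proof.
  rewrite is_Cderive_spec; unfold is_derive, filterdiff; split.
  - intros H; split; [apply is_linear_scal_l|].
    intros x Hx.
    apply (is_filter_lim_locally_unique (V := AbsRing_NormedModule C_AbsRing)) in Hx.
    rewrite <- Hx; intros eps.
    destruct (H eps (cond_pos eps)) as [d [Hd0 Hd]].
    exists (mkposreal d Hd0); exact Hd.
  - intros [_ H] eps He.
    destruct (H z (fun P HP => HP) (mkposreal eps He)) as [d Hd].
    exists d; split; [apply cond_pos|exact Hd].
Qed.

Lemma is_Cderive_ext (f g : C -> C) (z l : C) :
  (forall y, f y = g y) -> is_Cderive f z l -> is_Cderive g z l.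
Proof. apply is_derive_ext. Qed.

Lemma is_Cderive_const (c z : C) : is_Cderive (fun _ => c) z 0.
Proof. apply (is_derive_const (K := C_AbsRing) (V := C_NormedModule)). Qed.

Lemma is_Cderive_id (z : C) : is_Cderive (fun y => y) z 1.
Proof. apply is_Cderive_AbsRing, (is_derive_id (K := C_AbsRing)). Qed.

Lemma is_Cderive_plus (f g : C -> C) (z df dg : C) :
  is_Cderive f z df -> is_Cderive g z dg ->
  is_Cderive (fun y => f y + g y) z (df + dg).
Proof. apply (is_derive_plus (K := C_AbsRing) (V := C_NormedModule)). Qed.

Lemma is_Cderive_mult (f g : C -> C) (z df dg : C) :
  is_Cderive f z df -> is_Cderive g z dg ->
  is_Cderive (fun y => f y * g y) z (df * g z + f z * dg).
Proof.
  rewrite !is_Cderive_AbsRing; intros Hf Hg.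
  exact (is_derive_mult (K := C_AbsRing) f g z df dg Hf Hg Cmult_comm).
Qed.

Lemma is_Cderive_scal (c : C) (f : C -> C) (z df : C) :
  is_Cderive f z df -> is_Cderive (fun y => c * f y) z (c * df).
Proof.
  intros Hf.
  replace (c * df) with (0 * f z + c * df) by ring.
  apply is_Cderive_mult; [apply is_Cderive_const|exact Hf].
Qed.

Lemma is_Cderive_comp (f g : C -> C) (z df dg : C) :
  is_Cderive f (g z) df -> is_Cderive g z dg ->
  is_Cderive (fun y => f (g y)) z (dg * df).
Proof.
  intros Hf Hg; apply is_Cderive_AbsRing in Hg.
  exact (is_derive_comp (K := C_AbsRing) (V := C_NormedModule) f g z df dg Hf Hg).
Qed.

Lemma is_Cderive_quadratic (f : C -> C) (z l : C) (delta K : R) :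
  (0 < delta)%R ->
  (forall y, (Cmod (y - z) < delta)%R ->
     (Cmod (f y - f z - (y - z) * l) <= K * Cmod (y - z) ^ 2)%R) ->
  is_Cderive f z l.
Proof.
  intros Hd H; apply is_Cderive_spec; intros eps He.
  (* [K] carries no sign assumption; [Rabs K + 1] is a positive upper bound of it. *)
  assert (HK : (0 < Rabs K + 1)%R) by (pose proof (Rabs_pos K); lra).
  exists (Rmin delta (eps / (Rabs K + 1))); split.
  { apply Rmin_pos; [exact Hd|apply Rdiv_lt_0_compat; assumption]. }
  intros y Hy.
  eapply Rle_trans; [apply H; eapply Rlt_le_trans; [exact Hy|apply Rmin_l]|].
  assert (Hy' : (Cmod (y - z) < eps / (Rabs K + 1))%R)
    by (eapply Rlt_le_trans; [exact Hy|apply Rmin_r]).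
  apply (Rlt_div_r _ _ _ HK) in Hy'.
  pose proof (Cmod_ge_0 (y - z)); pose proof (Rle_abs K); nra.
Qed.

Lemma is_Cderive_inv (z : C) : z <> 0 -> is_Cderive Cinv z (- / (z * z)).
Proof.
  intros Hz; pose proof (proj1 (Cmod_gt_0 z) Hz) as Hm.
  (* The remainder is exactly [(y - z)^2 / (y z^2)], and [Cmod y > Cmod z / 2] on this disc. *)
  apply (is_Cderive_quadratic _ _ _ (Cmod z / 2) (2 / Cmod z ^ 3)); [lra|].
  intros y Hy.
  pose proof (Cmod_sub_triangle y (y - z)) as Ht.
  replace (y - (y - z)) with z in Ht by ring.
  assert (Hy0 : (Cmod z / 2 < Cmod y)%R) by lra.
  assert (Hyn : y <> 0) by (apply Cmod_gt_0; lra).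
  replace (/ y - / z - (y - z) * - / (z * z)) with ((y - z) * (y - z) / (y * (z * z)))
    by (field; auto).
  rewrite Cmod_div by (repeat apply Cmult_neq_0; assumption).
  rewrite !Cmod_mult.
  set (m := Cmod z) in *; set (d := Cmod (y - z)) in *; set (c := Cmod y) in *.
  apply Rle_div_l; [apply Rmult_lt_0_compat; nra|].
  replace (2 / m ^ 3 * d ^ 2 * (c * (m * m)))%R with (d ^ 2 * (2 * c / m))%R
    by (field; lra).
  assert (1 <= 2 * c / m)%R by (apply Rle_div_r; lra).
  pose proof (pow2_ge_0 d); nra.
Qed.

(** * Termwise differentiation *)

(** [T n] is the sum of [M k] over [k >= n]. Later arguments use only its recursion, which makes it
    convenient in inductions, and its limit 0. *)
Lemma ex_series_tail (M : nat -> R) :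
  (forall n, (0 <= M n)%R) -> ex_series M ->
  exists T : nat -> R, (forall n, (0 <= T n)%R) /\
    (forall n, T n = (M n + T (S n))%R) /\ is_lim_seq T 0.
Proof.
  intros HM [S0 HS].
  assert (Hle : forall n, (sum_n M n <= S0)%R).
  { apply (is_lim_seq_incr_compare (sum_n M) S0); [exact HS|].
    intros k; rewrite sum_Sn; specialize (HM (S k)); unfold plus; simpl; lra. }
  exists (fun n => S0 - match n with O => 0 | S m => sum_n M m end)%R.
  split; [|split].
  - intros [|n]; [|specialize (Hle n); lra].
    specialize (Hle 0%nat); rewrite sum_O in Hle; specialize (HM 0%nat); lra.
  - intros [|n]; [rewrite sum_O|rewrite sum_Sn; unfold plus; simpl]; lra.
  - apply is_lim_seq_incr_1.
    replace (Finite 0) with (Finite (S0 - S0)) by (f_equal; ring).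
    apply (is_lim_seq_minus' (fun _ => S0) (sum_n M));
      [apply is_lim_seq_const|exact HS].
Qed.

Lemma tail_increment_le (u : nat -> C) (M T : nat -> R) (c : R) :
  (0 <= c)%R -> (forall n, (0 <= T n)%R) -> (forall n, T n = (M n + T (S n))%R) ->
  (forall n, (Cmod (u (S n) - u n) <= M n * c)%R) ->
  forall n m, (n <= m)%nat -> (Cmod (u m - u n) <= T n * c)%R.
Proof.
  intros Hc HT0 HT Hu n m Hnm.
  (* The sharper bound with [T n - T m], the sum of [M] from [n] to [m - 1], is the one that is
     inductive. *)
  enough (Cmod (u m - u n) <= (T n - T m) * c)%R by (specialize (HT0 m); nra).
  induction Hnm as [|m Hnm IH].
  - replace (u n - u n) with (RtoC 0) by ring; rewrite Cmod_0; lra.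
  - replace (u (S m) - u n) with ((u (S m) - u m) + (u m - u n)) by ring.
    eapply Rle_trans; [apply Cmod_triangle|].
    specialize (Hu m); specialize (HT m); nra.
Qed.

(* The Lipschitz bound passes to the limit, so that no uniform bound on
   derivatives near [z] is needed. *)
Lemma is_Cderive_lim (f : nat -> C -> C) (F : C -> C) (d : nat -> C) (z : C)
    (M : nat -> R) :
  (forall n, (0 <= M n)%R) -> ex_series M ->
  (forall y, (Cmod (y - z) < 1)%R -> is_lim_Cseq (fun n => f n y) (F y)) ->
  (forall n, is_Cderive (f n) z (d n)) ->
  (forall n y, (Cmod (y - z) < 1)%R ->
    (Cmod ((f (S n) y - f n y) - (f (S n) z - f n z)) <= M n * Cmod (y - z))%R) ->
  exists l, is_lim_Cseq d l /\ is_Cderive F z l.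
Proof.
  intros HM0 HM HF Hd HL.
  destruct (ex_series_tail M HM0 HM) as [T [HT0 [HT HTl]]].
  (* A Lipschitz constant bounds the derivative: the difference quotient of [f (S n) - f n] is
     tested at one small real increment [h], lying inside both the disc of [H] and the unit disc. *)
  assert (Hdd : forall n, (Cmod (d (S n) - d n) <= M n)%R).
  { intros n; apply le_epsilon; intros eps He.
    assert (Hdn : is_Cderive (fun y => f (S n) y + - (1) * f n y) z
                    (d (S n) + - (1) * d n))
      by (apply is_Cderive_plus, is_Cderive_scal; apply Hd).
    destruct (proj1 (is_Cderive_spec _ _ _) Hdn eps He) as [r [Hr H]].
    set (h := (Rmin r 1 / 2)%R).
    assert (Hh : (0 < h < r /\ h < 1)%R).
    { unfold h; pose proof (Rmin_l r 1); pose proof (Rmin_r r 1).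
      assert (0 < Rmin r 1)%R by (apply Rmin_pos; lra); lra. }
    assert (Hz : Cmod (z + RtoC h - z) = h).
    { replace (z + RtoC h - z) with (RtoC h) by ring.
      rewrite Cmod_R; apply Rabs_pos_eq; lra. }
    specialize (H (z + RtoC h)); specialize (HL n (z + RtoC h)).
    rewrite Hz in H, HL; specialize (H ltac:(lra)); specialize (HL ltac:(lra)).
    replace (z + RtoC h - z) with (RtoC h) in H by ring.
    apply (Rmult_le_reg_r h); [lra|].
    replace (Cmod (d (S n) - d n) * h)%R with (Cmod (RtoC h * (d (S n) - d n)))
      by (rewrite Cmod_mult, Cmod_R, Rabs_pos_eq by lra; ring).
    set (A := f (S n) (z + RtoC h) - f n (z + RtoC h) - (f (S n) z - f n z)) in *.
    replace (RtoC h * (d (S n) - d n)) with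
      (A - (A - RtoC h * (d (S n) - d n))) by ring.
    eapply Rle_trans; [apply Cmod_sub_triangle|].
    replace (A - RtoC h * (d (S n) - d n)) with
      (f (S n) (z + RtoC h) + - (1) * f n (z + RtoC h) -
       (f (S n) z + - (1) * f n z) - RtoC h * (d (S n) + - (1) * d n))
      by (unfold A; ring).
    lra. }
  destruct (ex_lim_Cpartial (fun n => d (S n) - d n) M HM Hdd) as [l0 Hl0].
  exists (l0 + d 0%nat).
  assert (Hl : is_lim_Cseq d (l0 + d 0%nat)).
  { apply (is_lim_Cseq_ext (fun n => Cpartial (fun n => d (S n) - d n) n + d 0%nat)).
    - intros n; rewrite Cpartial_telescope; ring.
    - apply is_lim_Cseq_plus, is_lim_Cseq_const; exact Hl0. }
  split; [exact Hl|]; set (l := l0 + d 0%nat) in *; clearbody l; clear l0 Hl0.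
  assert (Hld : forall n, (Cmod (l - d n) <= T n)%R).
  { intros n; apply (Cmod_le_lim (fun m => d m - d n) _ _ n).
    - apply is_lim_Cseq_minus; [exact Hl|apply is_lim_Cseq_const].
    - intros m Hm; rewrite <- (Rmult_1_r (T n)).
      apply (tail_increment_le d M T 1); auto with real.
      intros k; rewrite Rmult_1_r; apply Hdd. }
  assert (HLF : forall n y, (Cmod (y - z) < 1)%R ->
    (Cmod (F y - F z - (f n y - f n z)) <= T n * Cmod (y - z))%R).
  { intros n y Hy.
    apply (Cmod_le_lim (fun m => f m y - f m z - (f n y - f n z)) _ _ n).
    - apply is_lim_Cseq_minus; [|apply is_lim_Cseq_const].
      apply is_lim_Cseq_minus; apply HF; [exact Hy|].
      replace (z - z) with (RtoC 0) by ring; rewrite Cmod_0; lra.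
    - intros m Hm.
      apply (tail_increment_le (fun m => f m y - f m z) M T); auto using Cmod_ge_0.
      intros k.
      replace (f (S k) y - f (S k) z - (f k y - f k z)) with
        (f (S k) y - f k y - (f (S k) z - f k z)) by ring.
      apply HL, Hy. }
  (* Three errors of size [eps / 3]: replacing the increment of [F] by that of [f N], the remainder
     of [f N] itself, and replacing [l] by [d N]. The tail [T N] controls the first and the last. *)
  apply is_Cderive_spec; intros eps He.
  apply is_lim_seq_spec in HTl.
  destruct (HTl (mkposreal (eps / 3) ltac:(lra))) as [N HN].
  specialize (HN N (le_n N)); simpl in HN.
  rewrite Rminus_0_r, Rabs_pos_eq in HN by apply HT0.
  destruct (proj1 (is_Cderive_spec _ _ _) (Hd N) (eps / 3)%R ltac:(lra))
    as [r [Hr H]].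
  exists (Rmin r 1); split; [apply Rmin_pos; lra|]; intros y Hy.
  pose proof (Rmin_l r 1); pose proof (Rmin_r r 1).
  specialize (H y ltac:(lra)); specialize (HLF N y ltac:(lra)).
  specialize (Hld N).
  replace (F y - F z - (y - z) * l) with
    ((F y - F z - (f N y - f N z)) +
     ((f N y - f N z - (y - z) * d N) - (y - z) * (l - d N))) by ring.
  eapply Rle_trans; [apply Cmod_triangle|].
  pose proof (Cmod_sub_triangle (f N y - f N z - (y - z) * d N) ((y - z) * (l - d N))).
  rewrite Cmod_mult in *.
  pose proof (Cmod_ge_0 (y - z)); nra.
Qed.

(** * The complex exponential *)

Lemma Cexp_0 : Cexp 0 = 1.
Proof.
  unfold Cexp, Re, Im; simpl; rewrite exp_0, cos_0, sin_0.
  unfold RtoC; f_equal; ring.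
Qed.

Lemma Cexp_plus (z w : C) : Cexp (z + w) = Cexp z * Cexp w.
Proof.
  unfold Cexp, Cmult, Re, Im; simpl.
  rewrite exp_plus, cos_plus, sin_plus; f_equal; ring.
Qed.

Lemma Cexp_nz (z : C) : Cexp z <> 0.
Proof.
  intros H; apply C1_nz.
  rewrite <- Cexp_0; replace (RtoC 0) with (z + - z) by ring.
  rewrite Cexp_plus, H; ring.
Qed.

Lemma Cexp_opp (z : C) : Cexp (- z) = / Cexp z.
Proof.
  pose proof (Cexp_nz z).
  replace (/ Cexp z) with (/ Cexp z * (Cexp z * Cexp (- z))).
  - field; assumption.
  - rewrite <- Cexp_plus; replace (z + - z) with (RtoC 0) by ring.
    rewrite Cexp_0; ring.
Qed.

Lemma Cexp_RtoC (a : R) : Cexp (RtoC a) = RtoC (exp a).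
Proof.
  unfold Cexp, Re, Im, RtoC; simpl; rewrite cos_0, sin_0; f_equal; ring.
Qed.

Lemma Cmod_Cexp (z : C) : Cmod (Cexp z) = exp (Re z).
Proof.
  unfold Cmod, Cexp; simpl.
  replace (_ + _)%R with (exp (Re z) * exp (Re z))%R.
  - apply sqrt_square, Rlt_le, exp_pos.
  - pose proof (sin2_cos2 (Im z)) as H; unfold Rsqr in H.
    replace (exp (Re z) * exp (Re z))%R with
      (exp (Re z) * exp (Re z) *
        (sin (Im z) * sin (Im z) + cos (Im z) * cos (Im z)))%R
      by (rewrite H; ring).
    ring.
Qed.

Lemma exp_le_compat (a b : R) : (a <= b)%R -> (exp a <= exp b)%R.
Proof.
  intros [H| ->]; [left; apply exp_increasing, H|right; reflexivity].
Qed.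

(** Everything comes from [1 + t <= exp t] at [t = a] and [t = -a]; the second, multiplied by
    [exp a], reads [exp a - 1 <= a * exp a]. *)
Lemma Rabs_exp_minus_1 (a : R) : (Rabs (exp a - 1) <= Rabs a * exp (Rabs a))%R.
Proof.
  pose proof (exp_ineq1_le a); pose proof (exp_ineq1_le (- a)).
  pose proof (exp_pos a); pose proof (exp_ineq1_le (Rabs a)).
  pose proof (Rabs_pos a).
  assert (exp a * exp (- a) = 1)%R
    by (rewrite <- exp_plus, Rplus_opp_r; apply exp_0).
  destruct (Rle_dec 0 a).
  - rewrite (Rabs_pos_eq a) in * by lra.
    rewrite Rabs_pos_eq by lra; nra.
  - rewrite (Rabs_left a) in * by lra.
    assert (exp a < 1)%R by (rewrite <- exp_0; apply exp_increasing; lra).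
    rewrite Rabs_left by lra; nra.
Qed.

Lemma Rabs_exp_minus_1_minus (a : R) :
  (Rabs (exp a - 1 - a) <= Rabs a ^ 2 * exp (Rabs a))%R.
Proof.
  pose proof (exp_ineq1_le a); pose proof (exp_ineq1_le (- a)).
  pose proof (exp_pos a); pose proof (Rabs_exp_minus_1 a).
  assert (exp a * exp (- a) = 1)%R
    by (rewrite <- exp_plus, Rplus_opp_r; apply exp_0).
  rewrite (Rabs_pos_eq (_ - _ - _)) by lra.
  assert (exp a - 1 - a <= a * (exp a - 1))%R by nra.
  assert (a * (exp a - 1) <= Rabs a * Rabs (exp a - 1))%R
    by (rewrite <- Rabs_mult; apply Rle_abs).
  pose proof (Rabs_pos a); nra.
Qed.

Lemma Rabs_sin_le (x : R) : (Rabs (sin x) <= Rabs x)%R.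
Proof.
  destruct (MVT_gen sin 0 x cos) as [c [_ Hc]].
  - intros y _; apply is_derive_Reals, derivable_pt_lim_sin.
  - intros y _; apply continuity_sin.
  - rewrite sin_0, !Rminus_0_r in Hc; rewrite Hc, Rabs_mult.
    assert (Rabs (cos c) <= 1)%R by (apply Rabs_le, COS_bound).
    pose proof (Rabs_pos x); nra.
Qed.

Lemma Rabs_cos_minus_1 (x : R) :
  (Rabs (cos x - 1) <= Rabs x)%R /\ (Rabs (cos x - 1) <= Rabs x ^ 2)%R.
Proof.
  replace (cos x - 1)%R with (- (2 * (sin (x / 2) * sin (x / 2))))%R.
  2:{ replace x with (2 * (x / 2))%R at 3 by field; rewrite cos_2a_sin; ring. }
  rewrite Rabs_Ropp, !Rabs_mult, (Rabs_pos_eq 2) by lra.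
  pose proof (Rabs_sin_le (x / 2)) as H.
  rewrite (Rabs_div x 2), (Rabs_pos_eq 2) in H by lra.
  assert (Rabs (sin (x / 2)) <= 1)%R by (apply Rabs_le, SIN_bound).
  pose proof (Rabs_pos (sin (x / 2))); pose proof (Rabs_pos x); split; nra.
Qed.

Lemma Rabs_sin_minus (x : R) : (Rabs (sin x - x) <= Rabs x ^ 2)%R.
Proof.
  destruct (MVT_gen (fun y => sin y - y)%R 0 x (fun y => cos y - 1)%R)
    as [c [Hc1 Hc]].
  - intros y _; apply is_derive_Reals, derivable_pt_lim_minus;
      [apply derivable_pt_lim_sin|apply derivable_pt_lim_id].
  - intros y _; apply continuity_pt_minus;
      [apply continuity_sin|apply continuity_pt_id].
  - rewrite sin_0, !Rminus_0_r in Hc; rewrite Hc, Rabs_mult.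
    pose proof (proj1 (Rabs_cos_minus_1 c)) as H.
    assert (Rabs c <= Rabs x)%R.
    { revert Hc1; unfold Rmin, Rmax; destruct (Rle_dec 0 x); intros [H1 H2].
      - rewrite !Rabs_pos_eq; lra.
      - rewrite !Rabs_left1; lra. }
    pose proof (Rabs_pos x); nra.
Qed.

Lemma Cexp_quadratic (R0 : R) :
  (0 <= R0)%R -> exists K : R, (0 <= K)%R /\ forall w : C, (Cmod w <= R0)%R ->
    (Cmod (Cexp w - 1 - w) <= K * Cmod w ^ 2)%R.
Proof.
  (* Sum of the four bounds below: [exp R0] and [1 + R0] from the real part, [exp R0] and 1 from the
     imaginary part. *)
  intros HR; exists (2 * exp R0 + R0 + 2)%R.
  pose proof (exp_pos R0); split; [lra|]; intros w Hw.
  eapply Rle_trans; [apply Cmod_le_Re_Im|].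
  pose proof (re_le_Cmod w) as Ha; pose proof (im_le_Cmod w) as Hb.
  destruct w as [a b]; set (m := Cmod (a, b)) in *.
  unfold Cexp, Re, Im in *; simpl in *.
  replace (exp a * cos b + - (1) + - a)%R with
    ((exp a - 1 - a) * cos b + (1 + a) * (cos b - 1))%R by ring.
  replace (exp a * sin b + - 0 + - b)%R with
    ((exp a - 1) * sin b + (sin b - b))%R by ring.
  pose proof (Rabs_triang ((exp a - 1 - a) * cos b) ((1 + a) * (cos b - 1))) as H1.
  pose proof (Rabs_triang ((exp a - 1) * sin b) (sin b - b)) as H2.
  rewrite !Rabs_mult in *.
  pose proof (Rabs_exp_minus_1_minus a); pose proof (Rabs_exp_minus_1 a).
  pose proof (proj2 (Rabs_cos_minus_1 b)); pose proof (Rabs_sin_minus b).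
  pose proof (Rabs_sin_le b).
  assert (Rabs (cos b) <= 1)%R by (apply Rabs_le, COS_bound).
  assert (exp (Rabs a) <= exp R0)%R by (apply exp_le_compat; lra).
  pose proof (exp_pos (Rabs a)).
  pose proof (Rabs_triang 1 a) as Ht; rewrite Rabs_R1 in Ht.
  pose proof (Rabs_pos a); pose proof (Rabs_pos b).
  pose proof (Rabs_pos (cos b)); pose proof (Rabs_pos (sin b)).
  pose proof (Rabs_pos (exp a - 1 - a)); pose proof (Rabs_pos (exp a - 1)).
  pose proof (Rabs_pos (cos b - 1)); pose proof (Rabs_pos (1 + a)).
  assert (Rabs a ^ 2 <= m ^ 2)%R by (apply pow_incr; lra).
  assert (Rabs b ^ 2 <= m ^ 2)%R by (apply pow_incr; lra).
  assert (Rabs a * Rabs b <= m ^ 2)%R by nra.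
  assert (Rabs (exp a - 1 - a) * Rabs (cos b) <= m ^ 2 * exp R0)%R.
  { apply Rle_trans with (Rabs (exp a - 1 - a)); [nra|].
    apply Rle_trans with (Rabs a ^ 2 * exp (Rabs a))%R; [assumption|].
    apply Rmult_le_compat; try lra; apply pow2_ge_0. }
  assert (Rabs (1 + a) * Rabs (cos b - 1) <= (1 + R0) * m ^ 2)%R
    by (apply Rmult_le_compat; lra).
  assert (Rabs (exp a - 1) * Rabs (sin b) <= m ^ 2 * exp R0)%R.
  { apply Rle_trans with (Rabs a * exp (Rabs a) * Rabs b)%R.
    - apply Rmult_le_compat; lra.
    - replace (Rabs a * exp (Rabs a) * Rabs b)%R with
        (Rabs a * Rabs b * exp (Rabs a))%R by ring.
      apply Rmult_le_compat; nra. }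
  change (m * (m * 1))%R with (m ^ 2)%R; lra.
Qed.

(** The remainder [E w = Cexp w - 1 - w] has derivative [Cexp w - 1], of order [r] on the disc of
    radius [r]. The factor [r] is the point: for arguments of size [1/n] it supplies the second
    power of [1/n] in the Euler factors. With [d = w - w'] the difference is
    [Cexp w' * E d + (Cexp w' - 1) * d]. *)
Lemma Cexp_remainder_lipschitz (R0 : R) :
  (0 <= R0)%R -> exists K : R, (0 <= K)%R /\ forall (r : R) (w w' : C),
    (r <= R0)%R -> (Cmod w <= r)%R -> (Cmod w' <= r)%R ->
    (Cmod ((Cexp w - 1 - w) - (Cexp w' - 1 - w')) <= K * r * Cmod (w - w'))%R.
Proof.
  intros HR.
  (* Radius [2 * R0], because the estimate is applied to [w - w'] as well as to [w']. *)
  destruct (Cexp_quadratic (2 * R0) ltac:(lra)) as [K [HK0 HK]].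
  pose proof (exp_pos R0).
  exists (2 * exp R0 * K + 1 + K * R0)%R; split; [nra|].
  intros r w w' Hr Hw Hw'.
  set (d := w - w').
  replace (Cexp w - 1 - w - (Cexp w' - 1 - w')) with
    (Cexp w' * (Cexp d - 1 - d) + ((Cexp w' - 1 - w') + w') * d).
  2:{ replace (Cexp w) with (Cexp (w' + d)) by (unfold d; f_equal; ring).
      rewrite Cexp_plus; unfold d; ring. }
  pose proof (Cmod_sub_triangle w w') as Hd; fold d in Hd.
  eapply Rle_trans; [apply Cmod_triangle|]; rewrite !Cmod_mult, Cmod_Cexp.
  pose proof (HK d ltac:(lra)) as H1; pose proof (HK w' ltac:(lra)) as H2.
  pose proof (Cmod_triangle (Cexp w' - 1 - w') w') as H3.
  pose proof (re_le_Cmod w'); pose proof (Rle_abs (Re w')).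
  assert (exp (Re w') <= exp R0)%R by (apply exp_le_compat; lra).
  pose proof (Cmod_ge_0 w'); pose proof (Cmod_ge_0 d); pose proof (Cmod_ge_0 w).
  pose proof (exp_pos (Re w')).
  assert (Cmod (Cexp d - 1 - d) <= K * (2 * r) * Cmod d)%R.
  { eapply Rle_trans; [exact H1|].
    replace (K * Cmod d ^ 2)%R with (K * Cmod d * Cmod d)%R by ring.
    apply Rmult_le_compat_r; [lra|apply Rmult_le_compat_l; lra]. }
  assert (Cmod (Cexp w' - 1 - w' + w') <= (1 + K * R0) * r)%R.
  { assert (K * Cmod w' ^ 2 <= K * (R0 * r))%R
      by (apply Rmult_le_compat_l; nra); lra. }
  assert (exp (Re w') * Cmod (Cexp d - 1 - d) <= exp R0 * (K * (2 * r) * Cmod d))%R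
    by (apply Rmult_le_compat; auto using Cmod_ge_0; lra).
  assert (Cmod (Cexp w' - 1 - w' + w') * Cmod d <= (1 + K * R0) * r * Cmod d)%R
    by (apply Rmult_le_compat_r; lra).
  lra.
Qed.

Lemma is_Cderive_Cexp (z : C) : is_Cderive Cexp z (Cexp z).
Proof.
  destruct (Cexp_quadratic 1 ltac:(lra)) as [K [HK0 HK]].
  apply (is_Cderive_quadratic _ _ _ 1 (Cmod (Cexp z) * K)); [lra|].
  intros y Hy.
  replace (Cexp y - Cexp z - (y - z) * Cexp z) with
    (Cexp z * (Cexp (y - z) - 1 - (y - z))).
  2:{ replace (Cexp y) with (Cexp (z + (y - z))) by (f_equal; ring).
      rewrite Cexp_plus; ring. }
  rewrite Cmod_mult, Rmult_assoc.
  apply Rmult_le_compat_l; [apply Cmod_ge_0|apply HK; lra].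
Qed.

(** Continuity at [l], read off the derivative with [eps = 1]: near [l] the increment of [f] is at
    most [1 + Cmod d] times that of its argument. *)
Lemma is_lim_Cseq_comp (f : C -> C) (u : nat -> C) (l d : C) :
  is_Cderive f l d -> is_lim_Cseq u l -> is_lim_Cseq (fun n => f (u n)) (f l).
Proof.
  intros Hf Hu; apply is_lim_Cseq_spec; intros eps He.
  destruct (proj1 (is_Cderive_spec _ _ _) Hf 1%R ltac:(lra)) as [r [Hr H]].
  pose proof (Cmod_ge_0 d) as Hd.
  assert (Hb : (0 < Rmin r (eps / (1 + Cmod d)))%R)
    by (apply Rmin_pos; [lra|apply Rdiv_lt_0_compat; lra]).
  destruct (proj1 (is_lim_Cseq_spec _ _) Hu _ Hb) as [N HN].
  exists N; intros n Hn; specialize (HN n Hn).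
  pose proof (Rmin_l r (eps / (1 + Cmod d))).
  pose proof (Rmin_r r (eps / (1 + Cmod d))).
  specialize (H (u n) ltac:(lra)).
  assert (Hlt : (Cmod (u n - l) < eps / (1 + Cmod d))%R) by lra.
  apply Rlt_div_r in Hlt; [|lra].
  replace (f (u n) - f l) with
    ((f (u n) - f l - (u n - l) * d) + (u n - l) * d) by ring.
  eapply Rle_lt_trans; [apply Cmod_triangle|]; rewrite Cmod_mult; nra.
Qed.

(** * Principal logarithm and powers *)

Lemma Clog_pos (x : R) : (0 < x)%R -> Clog (RtoC x) = RtoC (ln x).
Proof.
  intros Hx; unfold Clog, Carg.
  rewrite Cmod_R, Rabs_pos_eq, re_RtoC, im_RtoC by lra.
  destruct (Rle_dec 0 0) as [_|n]; [|lra].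
  replace (x / x)%R with 1%R by (field; lra).
  rewrite acos_1; reflexivity.
Qed.

(** The imaginary part is [- 0], so [Carg] takes its nonnegative branch: the argument is [PI], as
    the convention for [(-x)^(2mu)] demands. *)
Lemma Clog_neg (x : R) : (0 < x)%R -> Clog (- RtoC x) = (ln x, PI).
Proof.
  intros Hx; unfold Clog, Carg.
  rewrite Cmod_opp, Cmod_R, Rabs_pos_eq by lra.
  unfold Copp, Re, Im, RtoC; simpl.
  destruct (Rle_dec 0 (- 0)) as [_|n]; [|lra].
  replace (- x / x)%R with (- (1))%R by (field; lra).
  rewrite acos_opp, acos_1; f_equal; ring.
Qed.

Lemma Cpower_plus (z a b : C) : Cpower z (a + b) = Cpower z a * Cpower z b.
Proof.
  unfold Cpower; rewrite <- Cexp_plus; f_equal; ring.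
Qed.

(** The hypothesis excludes [z = 0], since [Cexp] never vanishes. *)
Lemma Cpower_nat (z a : C) (n : nat) :
  Cexp (Clog z) = z -> Cpower z (a + RtoC (INR n)) = Cpower z a * z ^ n.
Proof.
  intros Hz; induction n as [|n IH].
  - simpl; rewrite Cmult_1_r; f_equal; ring.
  - rewrite S_INR, RtoC_plus.
    replace (a + (RtoC (INR n) + 1)) with ((a + RtoC (INR n)) + 1) by ring.
    rewrite Cpower_plus, IH, Cpow_S.
    unfold Cpower at 2; rewrite Cmult_1_l, Hz; ring.
Qed.

Lemma Cexp_Clog_neg (x : R) : (0 < x)%R -> Cexp (Clog (- RtoC x)) = - RtoC x.
Proof.
  intros Hx; rewrite Clog_neg by exact Hx.
  unfold Cexp, Re, Im; simpl; rewrite exp_ln, cos_PI, sin_PI by exact Hx.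
  unfold RtoC, Copp; simpl; f_equal; ring.
Qed.

(** * The reciprocal Gamma function *)

Definition log_step (n : nat) : R := (ln (INR (S n) + 1) - ln (INR (S n)))%R.

(** With [p = n + 1] this is [(1 + z/p) (1 + 1/p)^(-z)], the reciprocal of Euler's factor. The
    exponential cancels the term of first order in [1/p]. *)
Definition rgamma_factor (n : nat) (z : C) : C :=
  (1 + RtoC (/ INR (S n)) * z) * Cexp (- RtoC (log_step n) * z).

(* Equals [z (z+1) ... (z+n) / (n! (n+1)^z)]; the shift from [n^z] to [(n+1)^z]
   makes the quotient of consecutive terms [1 + O(1/n^2)]. *)
Fixpoint rgamma_seq (n : nat) (z : C) : C :=
  match n with
  | O => z
  | S m => rgamma_seq m z * rgamma_factor m z
  end.

Definition RGamma (z : C) : C := C_lim_seq (fun n => rgamma_seq n z).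

Lemma INR_S_pos (n : nat) : (0 < INR (S n))%R.
Proof. apply lt_0_INR; lia. Qed.

Lemma ln_le_minus_1 (x : R) : (0 < x)%R -> (ln x <= x - 1)%R.
Proof.
  intros Hx; pose proof (exp_ineq1_le (ln x)); rewrite exp_ln in *; lra.
Qed.

(** With [p = n + 1], applying [ln t <= t - 1] to [(p+1)/p] and to [p/(p+1)] encloses the step
    between [1/(p+1)] and [1/p], whose gap is [1/(p(p+1))]. *)
Lemma log_step_bound (n : nat) :
  (0 <= log_step n <= / INR (S n))%R /\
  (0 <= / INR (S n) - log_step n <= / INR (S n) ^ 2)%R.
Proof.
  unfold log_step; pose proof (INR_S_pos n) as Hp; set (p := INR (S n)) in *.
  assert (H1 : (ln (p + 1) - ln p <= / p)%R).
  { rewrite <- ln_div by lra.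
    eapply Rle_trans; [apply ln_le_minus_1, Rdiv_lt_0_compat; lra|].
    right; field; lra. }
  assert (H2 : (/ (p + 1) <= ln (p + 1) - ln p)%R).
  { enough (ln p - ln (p + 1) <= - / (p + 1))%R by lra.
    rewrite <- ln_div by lra.
    eapply Rle_trans; [apply ln_le_minus_1, Rdiv_lt_0_compat; lra|].
    right; field; lra. }
  assert (0 < / (p + 1))%R by (apply Rinv_0_lt_compat; lra).
  assert (/ p - / (p + 1) <= / p ^ 2)%R.
  { replace (/ p - / (p + 1))%R with (/ (p * (p + 1)))%R by (field; lra).
    apply Rinv_le_contravar; nra. }
  lra.
Qed.

(** With [s = 1/(n+1)], [c = log_step n] and [E w = Cexp w - 1 - w], the factor is [1 + (s - c) z -
    s c z^2 + (1 + s z) E (-c z)]. Here [s - c] and [s c] are of order [s^2], and so is the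
    Lipschitz constant of [E (-c z)]. *)
Lemma rgamma_factor_lipschitz (R0 : R) :
  (0 <= R0)%R -> exists K : R, (0 <= K)%R /\ forall (n : nat) (z y : C),
    (Cmod z <= R0)%R -> (Cmod y <= R0)%R ->
    (Cmod (rgamma_factor n y - rgamma_factor n z)
       <= K * / INR (S n) ^ 2 * Cmod (y - z))%R.
Proof.
  intros HR.
  destruct (Cexp_remainder_lipschitz R0 HR) as [K [HK0 HK]].
  (* The four summands are the constants of [T1] to [T4] below. *)
  exists (1 + 2 * R0 + K * R0 * R0 + (1 + R0) * K * R0)%R; split.
  { assert (0 <= K * R0)%R by nra; assert (0 <= K * R0 * R0)%R by nra; nra. }
  intros n z y Hz Hy.
  destruct (log_step_bound n) as [[Hc0 Hc1] [Hd0 Hd1]].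
  unfold rgamma_factor.
  pose proof (INR_S_pos n) as Hp.
  assert (Hs : (0 < / INR (S n))%R) by (apply Rinv_0_lt_compat; exact Hp).
  assert (Hs1 : (/ INR (S n) <= 1)%R).
  { rewrite <- Rinv_1; apply Rinv_le_contravar; [lra|].
    rewrite S_INR; pose proof (pos_INR n); lra. }
  rewrite <- pow_inv in *.
  set (s := (/ INR (S n))%R) in *; set (c := log_step n) in *.
  set (E := fun w : C => Cexp w - 1 - w).
  assert (HE : forall a b : C, (Cmod a <= R0)%R -> (Cmod b <= R0)%R ->
    (Cmod (E (- RtoC c * a)%C - E (- RtoC c * b)%C) <= K * (R0 * s) * (s * Cmod (a - b)))%R).
  { intros a b Ha Hb; unfold E.
    assert (Hm : forall v : C, Cmod (- RtoC c * v) = (c * Cmod v)%R)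
      by (intros v; rewrite Cmod_mult, Cmod_opp, Cmod_R, Rabs_pos_eq by lra; reflexivity).
    pose proof (Cmod_ge_0 a); pose proof (Cmod_ge_0 b); pose proof (Cmod_ge_0 (a - b)).
    eapply Rle_trans; [apply (HK (R0 * s)%R)|].
    - nra.
    - rewrite Hm; nra.
    - rewrite Hm; nra.
    - replace (- RtoC c * a - - RtoC c * b) with (- RtoC c * (a - b)) by ring.
      rewrite Hm; apply Rmult_le_compat_l; [|nra].
      apply Rmult_le_pos; nra. }
  assert (HE0 : (Cmod (E (- RtoC c * z)%C) <= K * R0 * R0 * s)%R).
  { specialize (HE z 0 Hz ltac:(rewrite Cmod_0; exact HR)).
    replace (E (- RtoC c * z) - E (- RtoC c * 0)) with (E (- RtoC c * z)) in HE.
    2:{ replace (- RtoC c * 0) with (RtoC 0) by ring.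
        unfold E; rewrite Cexp_0; ring. }
    replace (z - 0) with z in HE by ring.
    pose proof (Cmod_ge_0 z).
    eapply Rle_trans; [exact HE|].
    assert (0 <= K * R0)%R by nra.
    replace (K * (R0 * s) * (s * Cmod z))%R with (K * R0 * (s * (s * Cmod z)))%R by ring.
    replace (K * R0 * R0 * s)%R with (K * R0 * (s * R0))%R by ring.
    apply Rmult_le_compat_l; [lra|]; apply Rmult_le_compat_l; nra. }
  specialize (HE y z Hy Hz).
  replace ((1 + RtoC s * y) * Cexp (- RtoC c * y) - (1 + RtoC s * z) * Cexp (- RtoC c * z))
    with (RtoC (s - c) * (y - z) - RtoC (s * c) * ((y - z) * (y + z))
      + (RtoC s * (y - z) * E (- RtoC c * z)
         + (1 + RtoC s * y) * (E (- RtoC c * y) - E (- RtoC c * z)))).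
  2:{ unfold E; rewrite RtoC_minus, RtoC_mult; ring. }
  set (h := Cmod (y - z)) in *.
  assert (Hh : (0 <= h)%R) by apply Cmod_ge_0.
  assert (T1 : (Cmod (RtoC (s - c) * (y - z)) <= s ^ 2 * h)%R).
  { rewrite Cmod_mult, Cmod_R, Rabs_pos_eq by lra; fold h.
    apply Rmult_le_compat_r; lra. }
  assert (T2 : (Cmod (RtoC (s * c) * ((y - z) * (y + z))) <= 2 * R0 * s ^ 2 * h)%R).
  { rewrite !Cmod_mult, Cmod_R, Rabs_pos_eq by nra; fold h.
    pose proof (Cmod_triangle y z); pose proof (Cmod_ge_0 (y + z)).
    replace (2 * R0 * s ^ 2 * h)%R with (s * s * (h * (2 * R0)))%R by ring.
    apply Rmult_le_compat; nra. }
  assert (T3 : (Cmod (RtoC s * (y - z) * E (- RtoC c * z)%C) <= K * R0 * R0 * s ^ 2 * h)%R).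
  { rewrite !Cmod_mult, Cmod_R, Rabs_pos_eq by lra; fold h.
    replace (K * R0 * R0 * s ^ 2 * h)%R with (s * h * (K * R0 * R0 * s))%R by ring.
    apply Rmult_le_compat_l; nra. }
  assert (T4 : (Cmod ((1 + RtoC s * y) * (E (- RtoC c * y)%C - E (- RtoC c * z)%C))
      <= (1 + R0) * K * R0 * s ^ 2 * h)%R).
  { rewrite Cmod_mult.
    assert (Cmod (1 + RtoC s * y) <= 1 + R0)%R.
    { eapply Rle_trans; [apply Cmod_triangle|].
      rewrite Cmod_1, Cmod_mult, Cmod_R, Rabs_pos_eq by lra.
      pose proof (Cmod_ge_0 y); nra. }
    replace ((1 + R0) * K * R0 * s ^ 2 * h)%R with
      ((1 + R0) * (K * (R0 * s) * (s * h)))%R by ring.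
    apply Rmult_le_compat; auto using Cmod_ge_0. }
  eapply Rle_trans; [apply Cmod_triangle|].
  pose proof (Cmod_sub_triangle (RtoC (s - c) * (y - z)) (RtoC (s * c) * ((y - z) * (y + z)))).
  pose proof (Cmod_triangle (RtoC s * (y - z) * E (- RtoC c * z))
    ((1 + RtoC s * y) * (E (- RtoC c * y) - E (- RtoC c * z)))).
  lra.
Qed.

Lemma is_lim_seq_inv_INR : is_lim_seq (fun n => / INR (S n))%R 0.
Proof.
  apply (is_lim_seq_incr_1 (fun n => / INR n)%R).
  apply (is_lim_seq_inv (fun n => INR n) p_infty); [apply is_lim_seq_INR|easy].
Qed.

(** For [p >= 1] one has [1/p^2 <= 2/(p(p+1))], and the right side telescopes. *)
Lemma ex_series_inv_sq : ex_series (fun n => / INR (S n) ^ 2)%R.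
Proof.
  assert (Hs : is_series (fun n => / INR (S n) - / INR (S (S n)))%R 1%R).
  { change (is_lim_seq (sum_n (fun n => / INR (S n) - / INR (S (S n)))%R) 1%R).
    apply (is_lim_seq_ext (fun n => 1 - / INR (S (S n)))%R).
    - intros n; induction n as [|n IH].
      + rewrite sum_O; simpl; field.
      + rewrite sum_Sn, <- IH; unfold plus; simpl; ring.
    - replace (Finite 1) with (Finite (1 - 0)) by (f_equal; ring).
      apply is_lim_seq_minus'; [apply is_lim_seq_const|].
      apply (is_lim_seq_incr_1 (fun n => / INR (S n))%R), is_lim_seq_inv_INR. }
  apply (ex_series_le (fun n => / INR (S n) ^ 2)%R
    (fun n => 2 * (/ INR (S n) - / INR (S (S n))))%R).
  - intros n; change (Rabs (/ INR (S n) ^ 2) <= 2 * (/ INR (S n) - / INR (S (S n))))%R.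
    rewrite (S_INR (S n)); pose proof (INR_S_pos n).
    assert (1 <= INR (S n))%R by (rewrite S_INR; pose proof (pos_INR n); lra).
    set (p := INR (S n)) in *.
    rewrite Rabs_pos_eq by (apply Rlt_le, Rinv_0_lt_compat; nra).
    replace (2 * (/ p - / (p + 1)))%R with (/ (p * (p + 1) / 2))%R by (field; lra).
    apply Rinv_le_contravar; nra.
  - exact (ex_series_scal_l (V := R_NormedModule) 2%R _ (ex_intro _ 1%R Hs)).
Qed.

Lemma rgamma_factor_0 (n : nat) : rgamma_factor n 0 = 1.
Proof.
  unfold rgamma_factor; rewrite !Cmult_0_r, Cexp_0; ring.
Qed.

Lemma rgamma_factor_bound (R0 : R) :
  (0 <= R0)%R -> exists M : nat -> R, (forall n, (0 <= M n)%R) /\ ex_series M /\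
    (forall n z, (Cmod z <= R0)%R -> (Cmod (rgamma_factor n z - 1) <= M n)%R) /\
    (forall n z y, (Cmod z <= R0)%R -> (Cmod y <= R0)%R ->
      (Cmod (rgamma_factor n y - rgamma_factor n z) <= M n * Cmod (y - z))%R).
Proof.
  intros HR; destruct (rgamma_factor_lipschitz R0 HR) as [K [HK0 HK]].
  (* One majorant for two purposes: [K] is the Lipschitz constant, and [K * R0] bounds the distance
     to 1, which is the value of the factor at 0. *)
  exists (fun n => (K * (1 + R0)) * / INR (S n) ^ 2)%R.
  assert (Hs : forall n, (0 <= / INR (S n) ^ 2)%R)
    by (intros n; apply Rlt_le, Rinv_0_lt_compat, pow_lt, INR_S_pos).
  assert (HKR : (0 <= K * R0)%R) by nra.
  split; [|split; [|split]].
  - intros n; apply Rmult_le_pos; [lra|apply Hs].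
  - exact (ex_series_scal_l (V := R_NormedModule) (K * (1 + R0))%R _ ex_series_inv_sq).
  - intros n z Hz; specialize (HK n 0 z ltac:(rewrite Cmod_0; exact HR) Hz).
    rewrite rgamma_factor_0 in HK.
    replace (z - 0) with z in HK by ring.
    eapply Rle_trans; [exact HK|].
    specialize (Hs n); pose proof (Cmod_ge_0 z).
    replace (K * / INR (S n) ^ 2 * Cmod z)%R with (K * Cmod z * / INR (S n) ^ 2)%R by ring.
    apply Rmult_le_compat_r; nra.
  - intros n z y Hz Hy; eapply Rle_trans; [apply HK; assumption|].
    specialize (Hs n); apply Rmult_le_compat_r; [apply Cmod_ge_0|].
    apply Rmult_le_compat_r; lra.
Qed.

(** Inductive step for bounding the products of [1 + M k] by the exponential of the sum of the
    [M k], that partial sum being written as [T 0 - T n]. *)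
Lemma exp_tail_step (M a b : R) : a = (M + b)%R -> (0 <= M)%R ->
  forall t, (exp (t - a) * (1 + M) <= exp (t - b))%R.
Proof.
  intros -> HM t; replace (t - b)%R with ((t - (M + b)) + M)%R by ring.
  rewrite exp_plus; apply Rmult_le_compat_l; [apply Rlt_le, exp_pos|].
  apply exp_ineq1_le.
Qed.

Lemma rgamma_seq_bound (R0 : R) :
  (1 <= R0)%R -> exists (M : nat -> R), (forall n, (0 <= M n)%R) /\ ex_series M /\
    (forall n z, (Cmod z <= R0)%R ->
      (Cmod (rgamma_seq (S n) z - rgamma_seq n z) <= M n)%R) /\
    (forall n z y, (Cmod z <= R0)%R -> (Cmod y <= R0)%R ->
      (Cmod ((rgamma_seq (S n) y - rgamma_seq n y) - (rgamma_seq (S n) z - rgamma_seq n z))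
        <= M n * Cmod (y - z))%R).
Proof.
  intros HR.
  destruct (rgamma_factor_bound R0 ltac:(lra)) as [M [HM0 [HM [HM1 HM2]]]].
  destruct (ex_series_tail M HM0 HM) as [T [HT0 [HT _]]].
  assert (Hexp : forall n, (exp (T 0%nat - T n) <= exp (T 0%nat))%R)
    by (intros n; apply exp_le_compat; specialize (HT0 n); lra).
  set (P := (R0 * exp (T 0%nat))%R).
  assert (HP : (0 < P)%R) by (apply Rmult_lt_0_compat; [lra|apply exp_pos]).
  assert (Hf : forall n z, (Cmod z <= R0)%R -> (Cmod (rgamma_factor n z) <= 1 + M n)%R).
  { intros n z Hz; specialize (HM1 n z Hz).
    replace (rgamma_factor n z) with (1 + (rgamma_factor n z - 1)) by ring.
    eapply Rle_trans; [apply Cmod_triangle|]; rewrite Cmod_1; lra. }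
  assert (HB : forall n z, (Cmod z <= R0)%R -> (Cmod (rgamma_seq n z) <= P)%R).
  { intros n z Hz.
    apply Rle_trans with (R0 * exp (T 0%nat - T n))%R;
      [|apply Rmult_le_compat_l; [lra|apply Hexp]].
    induction n as [|n IH]; simpl.
    - rewrite Rminus_diag, exp_0; lra.
    - rewrite Cmod_mult.
      apply Rle_trans with (R0 * exp (T 0%nat - T n) * (1 + M n))%R.
      + apply Rmult_le_compat; auto using Cmod_ge_0.
      + rewrite Rmult_assoc; apply Rmult_le_compat_l; [lra|].
        apply exp_tail_step; auto. }
  set (L := ((1 + P) * exp (T 0%nat))%R).
  assert (HL : forall n z y, (Cmod z <= R0)%R -> (Cmod y <= R0)%R ->
    (Cmod (rgamma_seq n y - rgamma_seq n z) <= L * Cmod (y - z))%R).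
  { intros n z y Hz Hy; pose proof (Cmod_ge_0 (y - z)) as Hh.
    (* A Lipschitz constant [q] of the partial product becomes [q (1 + M n) + P * M n] at the next
       step, starting from 1. The expression [(1 + P) * exp (T 0 - T n) - P] starts at 1 and
       dominates this recursion. *)
    apply Rle_trans with (((1 + P) * exp (T 0%nat - T n) - P) * Cmod (y - z))%R.
    2:{ apply Rmult_le_compat_r; [exact Hh|]; unfold L.
        specialize (Hexp n); nra. }
    induction n as [|n IH]; simpl.
    - rewrite Rminus_diag, exp_0; lra.
    - replace (rgamma_seq n y * rgamma_factor n y - rgamma_seq n z * rgamma_factor n z)
        with ((rgamma_seq n y - rgamma_seq n z) * rgamma_factor n y
              + rgamma_seq n z * (rgamma_factor n y - rgamma_factor n z)) by ring.
      eapply Rle_trans; [apply Cmod_triangle|]; rewrite !Cmod_mult.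
      assert (H1 : (Cmod (rgamma_seq n y - rgamma_seq n z) * Cmod (rgamma_factor n y)
        <= ((1 + P) * exp (T 0%nat - T n) - P) * Cmod (y - z) * (1 + M n))%R)
        by (apply Rmult_le_compat; auto using Cmod_ge_0).
      assert (H2 : (Cmod (rgamma_seq n z) * Cmod (rgamma_factor n y - rgamma_factor n z)
        <= P * (M n * Cmod (y - z)))%R)
        by (apply Rmult_le_compat; auto using Cmod_ge_0).
      pose proof (exp_tail_step _ _ _ (HT n) (HM0 n) (T 0%nat)) as H3.
      apply Rle_trans with
        (((1 + P) * (exp (T 0%nat - T n) * (1 + M n)) - P) * Cmod (y - z))%R; [lra|].
      apply Rmult_le_compat_r; [exact Hh|]; nra. }
  exists (fun n => (L + P) * M n)%R.
  assert (HLp : (0 <= L)%R)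
    by (apply Rmult_le_pos; [lra|apply Rlt_le, exp_pos]).
  split; [|split; [|split]].
  - intros n; apply Rmult_le_pos; [lra|apply HM0].
  - exact (ex_series_scal_l (V := R_NormedModule) (L + P)%R _ HM).
  - intros n z Hz; simpl.
    replace (rgamma_seq n z * rgamma_factor n z - rgamma_seq n z) with
      (rgamma_seq n z * (rgamma_factor n z - 1)) by ring.
    rewrite Cmod_mult; specialize (HM0 n).
    apply Rmult_le_compat; auto using Cmod_ge_0.
    specialize (HB n z Hz); lra.
  - intros n z y Hz Hy; simpl.
    replace (rgamma_seq n y * rgamma_factor n y - rgamma_seq n y
             - (rgamma_seq n z * rgamma_factor n z - rgamma_seq n z))
      with ((rgamma_seq n y - rgamma_seq n z) * (rgamma_factor n y - 1)
            + rgamma_seq n z * (rgamma_factor n y - rgamma_factor n z)) by ring.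
    eapply Rle_trans; [apply Cmod_triangle|]; rewrite !Cmod_mult.
    assert (H1 : (Cmod (rgamma_seq n y - rgamma_seq n z) * Cmod (rgamma_factor n y - 1)
      <= L * Cmod (y - z) * M n)%R)
      by (apply Rmult_le_compat; auto using Cmod_ge_0).
    assert (H2 : (Cmod (rgamma_seq n z) * Cmod (rgamma_factor n y - rgamma_factor n z)
      <= P * (M n * Cmod (y - z)))%R)
      by (apply Rmult_le_compat; auto using Cmod_ge_0).
    lra.
Qed.

Lemma is_lim_rgamma_seq (z : C) : is_lim_Cseq (fun n => rgamma_seq n z) (RGamma z).
Proof.
  destruct (rgamma_seq_bound (1 + Cmod z)) as [M [_ [HM [H _]]]].
  { pose proof (Cmod_ge_0 z); lra. }
  destruct (ex_lim_Cpartial (fun n => rgamma_seq (S n) z - rgamma_seq n z) M HM)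
    as [l Hl]; [intros n; apply H; lra|].
  assert (Hlim : is_lim_Cseq (fun n => rgamma_seq n z) (l + z)).
  { apply (is_lim_Cseq_ext (fun n =>
      Cpartial (fun n => rgamma_seq (S n) z - rgamma_seq n z) n + z)).
    - intros n; rewrite (Cpartial_telescope (fun n => rgamma_seq n z)); simpl; ring.
    - apply is_lim_Cseq_plus, is_lim_Cseq_const; exact Hl. }
  unfold RGamma; rewrite (C_lim_seq_unique _ _ Hlim); exact Hlim.
Qed.

Definition drgamma_factor (n : nat) (z : C) : C :=
  RtoC (/ INR (S n)) * Cexp (- RtoC (log_step n) * z)
  + (1 + RtoC (/ INR (S n)) * z)
    * (- RtoC (log_step n) * Cexp (- RtoC (log_step n) * z)).

Fixpoint drgamma_seq (n : nat) (z : C) : C :=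
  match n with
  | O => 1
  | S m => drgamma_seq m z * rgamma_factor m z + rgamma_seq m z * drgamma_factor m z
  end.

Lemma is_Cderive_linear (a z : C) : is_Cderive (fun y => a * y) z a.
Proof.
  pose proof (is_Cderive_scal a _ z 1 (is_Cderive_id z)) as H.
  rewrite Cmult_1_r in H; exact H.
Qed.

Lemma is_Cderive_rgamma_seq (n : nat) (z : C) :
  is_Cderive (rgamma_seq n) z (drgamma_seq n z).
Proof.
  induction n as [|n IH]; [apply is_Cderive_id|].
  apply (is_Cderive_mult (rgamma_seq n) (rgamma_factor n)); [exact IH|].
  apply (is_Cderive_mult (fun y => 1 + RtoC (/ INR (S n)) * y)
           (fun y => Cexp (- RtoC (log_step n) * y))).
  - pose proof (is_Cderive_plus _ _ z _ _ (is_Cderive_const 1 z)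
      (is_Cderive_linear (RtoC (/ INR (S n))) z)) as H.
    rewrite Cplus_0_l in H; exact H.
  - apply (is_Cderive_comp Cexp); [apply is_Cderive_Cexp|apply is_Cderive_linear].
Qed.

(** The derivative is exposed as a limit so that it can be computed at 0; at other points its
    existence suffices. *)
Lemma ex_Cderive_RGamma (z : C) :
  exists l, is_lim_Cseq (fun n => drgamma_seq n z) l /\ is_Cderive RGamma z l.
Proof.
  pose proof (Cmod_ge_0 z).
  destruct (rgamma_seq_bound (1 + Cmod z)) as [M [HM0 [HM [_ H2]]]]; [lra|].
  apply (is_Cderive_lim rgamma_seq RGamma _ z M HM0 HM).
  - intros y _; apply is_lim_rgamma_seq.
  - intros n; apply is_Cderive_rgamma_seq.
  - intros n y Hy; apply H2; [lra|].
    replace y with (z + (y - z)) by ring.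
    eapply Rle_trans; [apply Cmod_triangle|]; lra.
Qed.

Lemma rgamma_seq_0 (n : nat) : rgamma_seq n 0 = 0.
Proof. induction n as [|n IH]; simpl; [|rewrite IH; ring]; reflexivity. Qed.

Lemma RGamma_0 : RGamma 0 = 0.
Proof.
  apply C_lim_seq_unique, (is_lim_Cseq_ext (fun _ => RtoC 0)).
  - intros n; symmetry; apply rgamma_seq_0.
  - apply is_lim_Cseq_const.
Qed.

Lemma is_Cderive_RGamma_0 : is_Cderive RGamma 0 1.
Proof.
  destruct (ex_Cderive_RGamma 0) as [l [Hl Hd]].
  replace (RtoC 1) with l; [exact Hd|].
  apply (is_lim_Cseq_unique _ _ _ Hl), (is_lim_Cseq_ext (fun _ => RtoC 1)).
  (* At 0 every factor is 1 and every partial product is 0, so the product rule leaves the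
     derivative 1 of the leading factor [z]. *)
  - intros n; induction n as [|n IH]; simpl; [reflexivity|].
    rewrite <- IH, rgamma_factor_0, rgamma_seq_0; ring.
  - apply is_lim_Cseq_const.
Qed.

Definition is_nonpos_int (z : C) : Prop := exists n : nat, z = - RtoC (INR n).

Lemma rgamma_factor_nz (n : nat) (z : C) :
  ~ is_nonpos_int z -> rgamma_factor n z <> 0.
Proof.
  intros Hz; apply Cmult_neq_0; [|apply Cexp_nz].
  intros H; apply Hz; exists (S n).
  pose proof (INR_S_pos n).
  rewrite RtoC_inv in H by lra.
  assert (Hn : RtoC (INR (S n)) <> 0) by (intros H1; apply RtoC_inj in H1; lra).
  replace z with (RtoC (INR (S n)) * (1 + / RtoC (INR (S n)) * z) - RtoC (INR (S n)))
    by (field; exact Hn).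
  rewrite H; ring.
Qed.

Lemma rgamma_seq_nz (n : nat) (z : C) : ~ is_nonpos_int z -> rgamma_seq n z <> 0.
Proof.
  intros Hz; induction n as [|n IH]; simpl.
  - intros H; apply Hz; exists 0%nat; rewrite H; simpl; ring.
  - apply Cmult_neq_0; [exact IH|apply rgamma_factor_nz, Hz].
Qed.

(* A tail of the product stays away from 0 because
   [prod (1 - M_k) >= 1 - sum M_k >= 1/2]. *)
Lemma RGamma_nz (z : C) : ~ is_nonpos_int z -> RGamma z <> 0.
Proof.
  intros Hz.
  destruct (rgamma_factor_bound (Cmod z) (Cmod_ge_0 z)) as [M [HM0 [HM [HM1 _]]]].
  destruct (ex_series_tail M HM0 HM) as [T [HT0 [HT HTl]]].
  apply is_lim_seq_spec in HTl.
  destruct (HTl (mkposreal (1 / 2) ltac:(lra))) as [N HN].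
  specialize (HN N (le_n N)); simpl in HN.
  rewrite Rminus_0_r, Rabs_pos_eq in HN by apply HT0.
  pose proof (proj1 (Cmod_gt_0 _) (rgamma_seq_nz N z Hz)) as Hp.
  assert (HTm : forall n, (N <= n)%nat -> (T n <= T N)%R).
  { intros n Hn; induction Hn as [|n Hn IH]; [lra|].
    specialize (HT n); specialize (HM0 n); lra. }
  assert (Hge : forall n, (N <= n)%nat ->
    (Cmod (rgamma_seq N z) * (1 - (T N - T n)) <= Cmod (rgamma_seq n z))%R).
  { intros n Hn; induction Hn as [|n Hn IH].
    - right; ring.
    - simpl; rewrite Cmod_mult.
      specialize (HM0 n); specialize (HM1 n z (Rle_refl _)).
      assert (Hf : (1 - M n <= Cmod (rgamma_factor n z))%R).
      { pose proof (Cmod_sub_triangle (rgamma_factor n z) (rgamma_factor n z - 1)) as H.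
        replace (rgamma_factor n z - (rgamma_factor n z - 1)) with (RtoC 1) in H by ring.
        rewrite Cmod_1 in H; lra. }
      assert (HTS : (T (S n) = T n - M n)%R) by (rewrite (HT n); ring).
      specialize (HTm n Hn).
      pose proof (HT0 n); pose proof (HT0 (S n)).
      set (a := Cmod (rgamma_seq N z)) in *.
      set (b := Cmod (rgamma_seq n z)) in *.
      apply Rle_trans with (a * (1 - (T N - T n)) * (1 - M n))%R.
      + assert (0 <= a * ((T N - T n) * M n))%R
          by (apply Rmult_le_pos; [lra|apply Rmult_le_pos; lra]).
        rewrite HTS; lra.
      + apply Rmult_le_compat; try lra; apply Rmult_le_pos; lra. }
  apply Cmod_gt_0.
  apply Rlt_le_trans with (Cmod (rgamma_seq N z) / 2)%R; [lra|].
  apply (Cmod_ge_lim _ _ _ N (is_lim_rgamma_seq z)).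
  intros n Hn; specialize (Hge n Hn); specialize (HT0 n); nra.
Qed.

(** * Euler's limit formula and the functional equation *)

Lemma pochhammer_shift (z : C) (n : nat) :
  z * pochhammer (z + 1) n = pochhammer z (S n).
Proof.
  induction n as [|n IH]; [simpl; ring|].
  change (pochhammer z (S (S n))) with (pochhammer z (S n) * (z + RtoC (INR (S n)))).
  rewrite <- IH, S_INR, RtoC_plus; simpl; ring.
Qed.

Lemma pochhammer_nz (z : C) (n : nat) : ~ is_nonpos_int z -> pochhammer z n <> 0.
Proof.
  intros Hz; induction n as [|n IH]; [exact C1_nz|].
  apply Cmult_neq_0; [exact IH|].
  intros H; apply Hz; exists n.
  replace z with ((z + RtoC (INR n)) - RtoC (INR n)) by ring; rewrite H; ring.
Qed.

Lemma pochhammer_neg_nat (k n : nat) :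
  (k < n)%nat -> pochhammer (- RtoC (INR k)) n = 0.
Proof.
  intros H; induction H as [|n H IH]; simpl; [|rewrite IH]; ring.
Qed.

Lemma fact_RtoC_nz (n : nat) : RtoC (INR (fact n)) <> 0.
Proof.
  intros H; apply RtoC_inj in H; exact (INR_fact_neq_0 n H).
Qed.

Lemma rgamma_seq_eq (n : nat) (z : C) :
  rgamma_seq n z =
  pochhammer z (S n) * Cexp (- (RtoC (ln (INR (S n))) * z)) / RtoC (INR (fact n)).
Proof.
  induction n as [|n IH].
  - simpl; rewrite ln_1.
    replace (- (0 * z)) with (RtoC 0) by ring; rewrite Cexp_0; field; exact C1_nz.
  - change (rgamma_seq (S n) z) with (rgamma_seq n z * rgamma_factor n z).
    rewrite IH; unfold rgamma_factor, log_step.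
    change (pochhammer z (S (S n))) with (pochhammer z (S n) * (z + RtoC (INR (S n)))).
    rewrite (S_INR (S n)).
    change (fact (S n)) with (S n * fact n)%nat; rewrite mult_INR, RtoC_mult.
    pose proof (INR_S_pos n); rewrite RtoC_inv by lra.
    assert (Hn : RtoC (INR (S n)) <> 0) by (intros H1; apply RtoC_inj in H1; lra).
    pose proof (fact_RtoC_nz n).
    replace (- (RtoC (ln (INR (S n) + 1)) * z)) with
      (- (RtoC (ln (INR (S n))) * z)
       + - RtoC (ln (INR (S n) + 1) - ln (INR (S n))) * z)
      by (rewrite RtoC_minus; ring).
    rewrite Cexp_plus; field; split; assumption.
Qed.

Lemma is_lim_Cseq_RtoC (u : nat -> R) (l : R) :
  is_lim_seq u l -> is_lim_Cseq (fun n => RtoC (u n)) (RtoC l).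
Proof.
  intros H; apply is_lim_Cseq_Re_Im; split; [exact H|apply is_lim_seq_const].
Qed.

Lemma Cinv_0 : / RtoC 0 = 0.
Proof. unfold Cinv, RtoC; simpl; f_equal; unfold Rdiv; ring. Qed.

(* At the poles both sides are the junk value 0. *)
Lemma Gamma_eq (z : C) : Gamma z = / RGamma z.
Proof.
  unfold Gamma; apply C_lim_seq_unique.
  destruct (excluded_middle_informative (is_nonpos_int z)) as [[k Hk]|Hz].
  (* At [z = -k] the Pochhammer product contains a zero factor from index [k] on, so both sequences
     are eventually 0. *)
  - assert (H0 : RGamma z = 0).
    { apply C_lim_seq_unique, (is_lim_Cseq_ext_loc (fun _ => RtoC 0) _ _ k).
      - intros n Hn; rewrite rgamma_seq_eq, Hk, pochhammer_neg_nat by lia.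
        unfold Cdiv; ring.
      - apply is_lim_Cseq_const. }
    rewrite H0, Cinv_0.
    apply (is_lim_Cseq_ext_loc (fun _ => RtoC 0) _ _ k); [|apply is_lim_Cseq_const].
    intros n Hn; rewrite Hk, pochhammer_neg_nat by lia.
    unfold Cdiv; rewrite Cinv_0; ring.
  - apply is_lim_Cseq_incr.
    (* At index [n + 1] Euler's formula has [(n+1)^z] while [rgamma_seq] has [(n+2)^z]; the
       exponential of [log_step n * z], which tends to 1, makes up for it. *)
    apply (is_lim_Cseq_ext (fun n =>
      / (rgamma_seq (S n) z * Cexp (RtoC (log_step n) * z)))).
    + intros n; rewrite rgamma_seq_eq; unfold Cpower.
      rewrite Clog_pos by apply INR_S_pos.
      pose proof (pochhammer_nz z (S (S n)) Hz).
      pose proof (fact_RtoC_nz (S n)).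
      rewrite (S_INR (S n)); unfold log_step; rewrite RtoC_minus.
      replace ((RtoC (ln (INR (S n) + 1)) - RtoC (ln (INR (S n)))) * z) with
        (RtoC (ln (INR (S n) + 1)) * z + - (z * RtoC (ln (INR (S n))))) by ring.
      rewrite Cexp_plus, !Cexp_opp.
      pose proof (Cexp_nz (RtoC (ln (INR (S n) + 1)) * z)).
      pose proof (Cexp_nz (z * RtoC (ln (INR (S n))))).
      field; auto.
    + apply (is_lim_Cseq_comp Cinv _ _ (- / (RGamma z * RGamma z))).
      { apply is_Cderive_inv, RGamma_nz, Hz. }
      rewrite <- (Cmult_1_r (RGamma z)).
      apply is_lim_Cseq_mult.
      * apply (is_lim_Cseq_incr (fun n => rgamma_seq n z)), is_lim_rgamma_seq.
      * rewrite <- Cexp_0.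
        apply (is_lim_Cseq_comp Cexp _ _ (Cexp 0)); [apply is_Cderive_Cexp|].
        rewrite <- (Cmult_0_l z).
        apply is_lim_Cseq_mult; [|apply is_lim_Cseq_const].
        apply is_lim_Cseq_RtoC.
        apply (is_lim_seq_le_le (fun _ => 0%R) _ (fun n => / INR (S n))%R).
        -- intros n; apply log_step_bound.
        -- apply is_lim_seq_const.
        -- apply is_lim_seq_inv_INR.
Qed.

(** At finite level the functional equation holds up to the factor [1 + z/(n+1)], which tends to
    1. *)
Lemma RGamma_succ (z : C) : z * RGamma (z + 1) = RGamma z.
Proof.
  apply (is_lim_Cseq_unique (fun n => z * rgamma_seq n (z + 1))).
  - apply is_lim_Cseq_scal, is_lim_rgamma_seq.
  - replace (RGamma z) with (RGamma z * (1 + 0 * z)) by ring.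
    apply (is_lim_Cseq_ext (fun n => rgamma_seq n z * (1 + RtoC (/ INR (S n)) * z))).
    + intros n; rewrite !rgamma_seq_eq.
      pose proof (INR_S_pos n); rewrite RtoC_inv by lra.
      assert (Hn : RtoC (INR (S n)) <> 0) by (intros H1; apply RtoC_inj in H1; lra).
      pose proof (fact_RtoC_nz n).
      replace (- (RtoC (ln (INR (S n))) * (z + 1))) with
        (- (RtoC (ln (INR (S n))) * z) + - RtoC (ln (INR (S n)))) by ring.
      rewrite Cexp_plus, (Cexp_opp (RtoC _)), Cexp_RtoC, exp_ln by lra.
      transitivity (pochhammer z (S n) * (z + RtoC (INR (S n)))
        * (Cexp (- (RtoC (ln (INR (S n))) * z)) * / RtoC (INR (S n)))
        / RtoC (INR (fact n))); [field; split; assumption|].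
      change (pochhammer z (S n) * (z + RtoC (INR (S n)))) with (pochhammer z (S (S n))).
      rewrite <- pochhammer_shift; field; split; assumption.
    + apply is_lim_Cseq_mult; [apply is_lim_rgamma_seq|].
      apply is_lim_Cseq_plus; [apply is_lim_Cseq_const|].
      apply is_lim_Cseq_mult; [|apply is_lim_Cseq_const].
      apply is_lim_Cseq_RtoC, is_lim_seq_inv_INR.
Qed.

(** * Kummer's function *)

(** A real majorant of [pochhammer] on the disc of radius [r]. *)
Fixpoint rising (r : R) (n : nat) : R :=
  match n with O => 1 | S m => rising r m * (r + INR m) end%R.

Lemma rising_pos (r : R) (n : nat) : (0 < r)%R -> (0 < rising r n)%R.
Proof.
  intros Hr; induction n as [|n IH]; simpl; [lra|].
  pose proof (pos_INR n); apply Rmult_lt_0_compat; lra.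
Qed.

Lemma Cmod_plus_INR (a : C) (r : R) (n : nat) :
  (Cmod a <= r)%R -> (Cmod (a + RtoC (INR n)) <= r + INR n)%R.
Proof.
  intros Ha; eapply Rle_trans; [apply Cmod_triangle|].
  rewrite Cmod_R, Rabs_pos_eq by apply pos_INR; lra.
Qed.

(** As a polynomial in [a], [pochhammer a n] has nonnegative coefficients, so its Lipschitz constant
    on the disc is the derivative at [r], which by convexity is at most the increment from [r] to
    [r + 1]. The majorant thus remains a rising factorial, and one ratio test covers both the values
    and the increments. *)
Lemma pochhammer_bound (r : R) (n : nat) (a c : C) :
  (0 < r)%R -> (Cmod a <= r)%R -> (Cmod c <= r)%R ->
  (Cmod (pochhammer a n) <= rising r n)%R /\
  (Cmod (pochhammer a n - pochhammer c n)
     <= (rising (r + 1) n - rising r n) * Cmod (a - c))%R.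
Proof.
  intros Hr Ha Hc; pose proof (Cmod_ge_0 (a - c)) as Hh.
  induction n as [|n [IH1 IH2]]; simpl.
  - rewrite Cmod_1; split; [lra|].
    replace (1 - 1) with (RtoC 0) by ring; rewrite Cmod_0; lra.
  - pose proof (Cmod_plus_INR a r n Ha); pose proof (Cmod_plus_INR c r n Hc).
    pose proof (rising_pos r n Hr); pose proof (rising_pos (r + 1) n ltac:(lra)).
    split.
    + rewrite Cmod_mult; apply Rmult_le_compat; auto using Cmod_ge_0.
    + replace (pochhammer a n * (a + RtoC (INR n)) - pochhammer c n * (c + RtoC (INR n)))
        with (pochhammer a n * (a - c)
          + (pochhammer a n - pochhammer c n) * (c + RtoC (INR n))) by ring.
      eapply Rle_trans; [apply Cmod_triangle|]; rewrite !Cmod_mult.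
      assert (Cmod (pochhammer a n) * Cmod (a - c) <= rising r n * Cmod (a - c))%R
        by (apply Rmult_le_compat_r; lra).
      assert (Cmod (pochhammer a n - pochhammer c n) * Cmod (c + RtoC (INR n))
        <= (rising (r + 1) n - rising r n) * Cmod (a - c) * (r + INR n))%R
        by (apply Rmult_le_compat; auto using Cmod_ge_0).
      assert (rising r n <= rising (r + 1) n)%R.
      { clear - Hr; induction n as [|n IH]; simpl; [lra|].
        pose proof (pos_INR n); pose proof (rising_pos r n Hr).
        apply Rmult_le_compat; lra. }
      assert (0 <= (rising (r + 1) n - rising r n) * Cmod (a - c))%R
        by (apply Rmult_le_pos; lra).
      nra.
Qed.

(** The part of the series term that does not depend on [a], split off so that differentiation in
    [a] touches only [pochhammer a n]. *)
Definition kummer_coef (b : C) (x : R) (n : nat) : C :=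
  RtoC x ^ n / (pochhammer b n * RtoC (INR (fact n))).

Definition Kummer (a b : C) (x : R) : C := pFq (a :: nil) (b :: nil) (RtoC x).

Lemma kummer_coef_nz (b : C) (x : R) (n : nat) :
  ~ is_nonpos_int b -> (0 < x)%R -> kummer_coef b x n <> 0.
Proof.
  intros Hb Hx; pose proof (pochhammer_nz b n Hb); pose proof (fact_RtoC_nz n).
  assert (RtoC x <> 0) by (intros H1; apply RtoC_inj in H1; lra).
  pose proof (Cpow_nz (RtoC x) n ltac:(assumption)).
  intros H3; unfold kummer_coef in H3.
  apply (Cmult_neq_0 (RtoC x ^ n) (pochhammer b n * RtoC (INR (fact n)))); auto.
  - apply Cmult_neq_0; auto.
  - replace (RtoC x ^ n) with (RtoC x ^ n / (pochhammer b n * RtoC (INR (fact n)))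
      * (pochhammer b n * RtoC (INR (fact n)))) by (field; auto).
    rewrite H3; ring.
Qed.

Lemma kummer_coef_S (b : C) (x : R) (n : nat) :
  ~ is_nonpos_int b ->
  kummer_coef b x (S n) =
  kummer_coef b x n * (RtoC x / ((b + RtoC (INR n)) * RtoC (INR (S n)))).
Proof.
  intros Hb; pose proof (pochhammer_nz b (S n) Hb) as H1.
  pose proof (pochhammer_nz b n Hb).
  assert (b + RtoC (INR n) <> 0)
    by (intros H2; apply H1; simpl; rewrite H2; ring).
  pose proof (fact_RtoC_nz n); pose proof (INR_S_pos n).
  assert (RtoC (INR (S n)) <> 0) by (intros Hq; apply RtoC_inj in Hq; lra).
  unfold kummer_coef.
  change (fact (S n)) with (S n * fact n)%nat; rewrite mult_INR, RtoC_mult, Cpow_S.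
  change (pochhammer b (S n)) with (pochhammer b n * (b + RtoC (INR n))).
  field; auto.
Qed.

Lemma kummer_ex_series (b : C) (x r : R) :
  ~ is_nonpos_int b -> (0 < x)%R -> (0 < r)%R ->
  ex_series (fun n => rising r n * Cmod (kummer_coef b x n))%R.
Proof.
  intros Hb Hx Hr.
  assert (Hpos : forall n, (0 < rising r n * Cmod (kummer_coef b x n))%R).
  { intros n; apply Rmult_lt_0_compat; [apply rising_pos, Hr|].
    apply Cmod_gt_0, kummer_coef_nz; assumption. }
  apply (ex_series_ext (fun n => Rabs (rising r n * Cmod (kummer_coef b x n)))).
  { intros n; apply Rabs_pos_eq, Rlt_le, Hpos. }
  apply (ex_series_DAlembert _ 0%R); [lra| |].
  { intros n; apply Rgt_not_eq, Hpos. }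
  (* Beyond [2 * Cmod b + 1] the modulus of [b + n] is at least [(n+1)/2], which bounds the ratio of
     consecutive terms by [2 (r+1) x / (n+1)]. *)
  destruct (nfloor_ex (2 * Cmod b + 1)) as [N HN].
  { pose proof (Cmod_ge_0 b); lra. }
  apply (is_lim_seq_le_le_loc (fun _ => 0%R) _
    (fun n => (2 * (r + 1) * x) * / INR (S n))%R).
  - exists (S N); intros n Hn; split; [apply Rabs_pos|].
    rewrite kummer_coef_S by exact Hb.
    pose proof (rising_pos r n Hr) as Hrn.
    pose proof (proj1 (Cmod_gt_0 _) (kummer_coef_nz b x n Hb Hx)) as Hk.
    assert (HnN : (2 * Cmod b + 1 < INR n)%R).
    { apply Rlt_le_trans with (INR N + 1)%R; [apply HN|].
      rewrite <- S_INR; apply le_INR, Hn. }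
    assert (HbN : (INR (S n) / 2 <= Cmod (b + RtoC (INR n)))%R).
    { pose proof (Cmod_sub_triangle (b + RtoC (INR n)) b) as Ht.
      replace (b + RtoC (INR n) - b) with (RtoC (INR n)) in Ht by ring.
      rewrite Cmod_R, Rabs_pos_eq in Ht by apply pos_INR.
      rewrite S_INR; lra. }
    pose proof (INR_S_pos n) as Hp; pose proof (Cmod_ge_0 b).
    assert (Hbn : b + RtoC (INR n) <> 0) by (apply Cmod_gt_0; lra).
    assert (Hsn : RtoC (INR (S n)) <> 0) by (intros H2; apply RtoC_inj in H2; lra).
    rewrite Cmod_mult, Cmod_div by (apply Cmult_neq_0; assumption).
    rewrite Cmod_mult, !Cmod_R, !(Rabs_pos_eq x), (Rabs_pos_eq (INR (S n))) by lra.
    change (rising r (S n)) with (rising r n * (r + INR n))%R.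
    set (B := Cmod (b + RtoC (INR n))) in *.
    replace (rising r n * (r + INR n) *
        (Cmod (kummer_coef b x n) * (x / (B * INR (S n)))) /
        (rising r n * Cmod (kummer_coef b x n)))%R
      with ((r + INR n) * x / (B * INR (S n)))%R
      by (field; repeat split; lra).
    assert (HB : (0 < B * INR (S n))%R) by (apply Rmult_lt_0_compat; lra).
    rewrite Rabs_pos_eq.
    2:{ apply Rmult_le_pos; [apply Rmult_le_pos; lra|].
        apply Rlt_le, Rinv_0_lt_compat, HB. }
    apply Rle_div_l; [exact HB|].
    replace (2 * (r + 1) * x * / INR (S n) * (B * INR (S n)))%R with
      ((r + 1) * (2 * B) * x)%R by (field; lra).
    apply Rmult_le_compat_r; [lra|].
    apply Rle_trans with ((r + 1) * INR (S n))%R.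
    + rewrite S_INR; pose proof (pos_INR n); nra.
    + apply Rmult_le_compat_l; lra.
  - apply is_lim_seq_const.
  - replace (Finite 0) with (Rbar_mult (2 * (r + 1) * x)%R 0%R)
      by (simpl; f_equal; ring).
    apply is_lim_seq_scal_l, is_lim_seq_inv_INR.
Qed.

Lemma is_lim_Kummer (a b : C) (x : R) :
  ~ is_nonpos_int b -> (0 < x)%R ->
  is_lim_Cseq (Cpartial (fun n => pochhammer a n * kummer_coef b x n)) (Kummer a b x).
Proof.
  intros Hb Hx; pose proof (Cmod_ge_0 a).
  destruct (ex_lim_Cpartial (fun n => pochhammer a n * kummer_coef b x n)
    (fun n => rising (Cmod a + 1) n * Cmod (kummer_coef b x n))%R) as [l Hl].
  - apply kummer_ex_series; [assumption..|lra].
  - intros n; rewrite Cmod_mult; apply Rmult_le_compat_r; [apply Cmod_ge_0|].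
    apply (pochhammer_bound _ n a a); lra.
  - replace (Kummer a b x) with l; [exact Hl|].
    symmetry; apply C_series_unique.
    refine (is_lim_Cseq_ext _ _ _ _ Hl); intros n; apply Cpartial_ext; intros k.
    unfold kummer_coef; simpl.
    pose proof (pochhammer_nz b k Hb); pose proof (fact_RtoC_nz k).
    field; auto.
Qed.

Fixpoint dpochhammer (a : C) (n : nat) : C :=
  match n with
  | O => 0
  | S m => dpochhammer a m * (a + RtoC (INR m)) + pochhammer a m
  end.

Lemma is_Cderive_shift (c z : C) : is_Cderive (fun y => y + c) z 1.
Proof.
  pose proof (is_Cderive_plus _ _ z _ _ (is_Cderive_id z) (is_Cderive_const c z)) as H.
  rewrite Cplus_0_r in H; exact H.
Qed.

Lemma is_Cderive_pochhammer (n : nat) (a : C) :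
  is_Cderive (fun y => pochhammer y n) a (dpochhammer a n).
Proof.
  induction n as [|n IH]; [exact (is_Cderive_const 1 a)|]; simpl.
  rewrite <- (Cmult_1_r (pochhammer a n)).
  apply (is_Cderive_mult (fun y => pochhammer y n) (fun y => y + RtoC (INR n)));
    [exact IH|].
  apply is_Cderive_shift.
Qed.

Lemma ex_Cderive_Kummer (a b : C) (x : R) :
  ~ is_nonpos_int b -> (0 < x)%R ->
  exists l,
    is_lim_Cseq (Cpartial (fun n => dpochhammer a n * kummer_coef b x n)) l /\
    is_Cderive (fun y => Kummer y b x) a l.
Proof.
  intros Hb Hx; pose proof (Cmod_ge_0 a) as Ha.
  (* The disc of radius [r] about 0 contains the unit disc about [a]. *)
  set (r := (Cmod a + 1)%R).
  apply (is_Cderive_lim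
    (fun n y => Cpartial (fun k => pochhammer y k * kummer_coef b x k) n) _ _ _
    (fun n => rising (r + 1) n * Cmod (kummer_coef b x n))%R).
  - intros n; apply Rmult_le_pos; [|apply Cmod_ge_0].
    apply Rlt_le, rising_pos; unfold r; lra.
  - apply kummer_ex_series; [assumption..|unfold r; lra].
  - intros y _; apply is_lim_Kummer; assumption.
  - intros n; induction n as [|n IH]; cbn [Cpartial]; [exact (is_Cderive_const 0 a)|].
    apply is_Cderive_plus; [exact IH|].
    apply (is_Cderive_ext (fun y => kummer_coef b x n * pochhammer y n));
      [intros y; apply Cmult_comm|].
    rewrite (Cmult_comm (dpochhammer a n)).
    apply is_Cderive_scal, is_Cderive_pochhammer.
  - intros n y Hy; cbn [Cpartial].
    match goal with |- (Cmod ?e <= _)%R => replace e with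
      ((pochhammer y n - pochhammer a n) * kummer_coef b x n) by ring end.
    rewrite Cmod_mult.
    replace (rising (r + 1) n * Cmod (kummer_coef b x n) * Cmod (y - a))%R with
      (rising (r + 1) n * Cmod (y - a) * Cmod (kummer_coef b x n))%R by ring.
    apply Rmult_le_compat_r; [apply Cmod_ge_0|].
    assert (Hya : (Cmod y <= r)%R).
    { unfold r; replace y with (a + (y - a)) by ring.
      eapply Rle_trans; [apply Cmod_triangle|]; lra. }
    eapply Rle_trans;
      [apply (pochhammer_bound r n y a); [unfold r; lra|exact Hya|unfold r; lra]|].
    apply Rmult_le_compat_r; [apply Cmod_ge_0|].
    pose proof (rising_pos r n ltac:(unfold r; lra)); lra.
Qed.

(** * Kummer's function at [a = 0] and the incomplete gamma series *)

Lemma Cpartial_S (u : nat -> C) (n : nat) :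
  Cpartial u (S n) = u 0%nat + Cpartial (fun k => u (S k)) n.
Proof.
  induction n as [|n IH]; [simpl; ring|].
  change (Cpartial u (S n) + u (S n) =
    u 0%nat + (Cpartial (fun k => u (S k)) n + u (S n))).
  rewrite IH; ring.
Qed.

Lemma pochhammer_0_S (n : nat) : pochhammer 0 (S n) = 0.
Proof. rewrite <- pochhammer_shift; ring. Qed.

Lemma Kummer_0 (b : C) (x : R) :
  ~ is_nonpos_int b -> (0 < x)%R -> Kummer 0 b x = 1.
Proof.
  intros Hb Hx.
  apply (is_lim_Cseq_unique _ _ _ (is_lim_Kummer 0 b x Hb Hx)).
  apply is_lim_Cseq_incr, (is_lim_Cseq_ext (fun _ => RtoC 1)).
  - intros n; rewrite Cpartial_S.
    (* The vanishing terms are written [0 * 0] so that [Cpartial_scal] pulls a zero out of the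
       sum. *)
    rewrite (Cpartial_ext _ (fun _ => 0 * 0))
      by (intros k; rewrite pochhammer_0_S; ring).
    rewrite Cpartial_scal; unfold kummer_coef; simpl; field; exact C1_nz.
  - apply is_lim_Cseq_const.
Qed.

(** Differentiating [a (a+1) ... (a+n)] at 0 leaves only the product of the factors other than
    [a]. *)
Lemma dpochhammer_0_S (n : nat) : dpochhammer 0 (S n) = RtoC (INR (fact n)).
Proof.
  induction n as [|n IH]; [simpl; ring|].
  change (dpochhammer 0 (S (S n))) with
    (dpochhammer 0 (S n) * (0 + RtoC (INR (S n))) + pochhammer 0 (S n)).
  rewrite IH, pochhammer_0_S.
  change (fact (S n)) with (S n * fact n)%nat; rewrite mult_INR, RtoC_mult; ring.
Qed.

Lemma pochhammer_1 (n : nat) : pochhammer 1 n = RtoC (INR (fact n)).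
Proof.
  induction n as [|n IH]; [reflexivity|].
  change (fact (S n)) with (S n * fact n)%nat.
  rewrite mult_INR, S_INR, RtoC_mult, RtoC_plus; simpl; rewrite IH; ring.
Qed.

Lemma pochhammer_2 (n : nat) : pochhammer 2 n = RtoC (INR (fact (S n))).
Proof.
  rewrite <- pochhammer_1, <- pochhammer_shift, Cmult_1_l.
  f_equal; rewrite <- RtoC_plus; f_equal; ring.
Qed.

(** The term of index [k + 1] of the derivative is [k! x^(k+1) / ((b)_(k+1) (k+1)!)]. Now
    [(b)_(k+1) = b (b+1)_k], [(k+1)! = (2)_k] and [k! = (1)_k (1)_k / k!], which exhibits the 2F2
    with the prefactor [x/b]. *)
Lemma is_Cderive_Kummer_0 (b : C) (x : R) :
  ~ is_nonpos_int b -> (0 < x)%R ->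
  is_Cderive (fun a => Kummer a b x) 0
    (RtoC x / b * pFq (RtoC 1 :: RtoC 1 :: nil) (b + 1 :: RtoC 2 :: nil) (RtoC x)).
Proof.
  intros Hb Hx.
  destruct (ex_Cderive_Kummer 0 b x Hb Hx) as [l [Hl Hd]].
  assert (Hb0 : b <> 0) by (intros H; apply Hb; exists 0%nat; rewrite H; simpl; ring).
  assert (Hx0 : RtoC x <> 0) by (intros H1; apply RtoC_inj in H1; lra).
  (* Solving for the 2F2 turns the claim into the value of a series, within reach of
     [C_series_unique]. *)
  match goal with |- is_Cderive _ _ (_ * ?F) => replace F with (b / RtoC x * l) end.
  { replace (RtoC x / b * (b / RtoC x * l)) with l by (field; auto); exact Hd. }
  symmetry; apply C_series_unique.
  apply is_lim_Cseq_incr in Hl.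
  refine (is_lim_Cseq_ext _ _ _ _ (is_lim_Cseq_scal (b / RtoC x) _ _ Hl)).
  intros n; rewrite Cpartial_S.
  replace (dpochhammer 0 0 * kummer_coef b x 0) with (RtoC 0) by (simpl; ring).
  rewrite Cplus_0_l, <- Cpartial_scal; apply Cpartial_ext; intros k.
  rewrite dpochhammer_0_S; unfold kummer_coef; rewrite <- pochhammer_shift; simpl map.
  unfold Cprod_list, fold_right.
  rewrite pochhammer_1, pochhammer_2, Cpow_S.
  assert (pochhammer (b + 1) k <> 0).
  { intros H; apply (pochhammer_nz b (S k) Hb); rewrite <- pochhammer_shift, H; ring. }
  pose proof (fact_RtoC_nz k); pose proof (fact_RtoC_nz (S k)).
  field; auto.
Qed.

(** The ratio [(a)_k / (a+1)_k] telescopes to [a / (a+k)], and the signs [(-1)^k] cancel against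
    those of [(-x)^k]. *)
Lemma lower_gamma_Kummer (a : C) (x : R) :
  ~ is_nonpos_int a -> (0 < x)%R ->
  lower_gamma a (- RtoC x) = Cpower (- RtoC x) a / a * Kummer a (a + 1) x.
Proof.
  intros Ha Hx.
  assert (Ha1 : ~ is_nonpos_int (a + 1)).
  { intros [n Hn]; apply Ha; exists (S n); rewrite S_INR, RtoC_plus.
    replace a with (a + 1 - 1) by ring; rewrite Hn; ring. }
  apply C_series_unique.
  refine (is_lim_Cseq_ext _ _ _ _
    (is_lim_Cseq_scal (Cpower (- RtoC x) a / a) _ _ (is_lim_Kummer a (a + 1) x Ha1 Hx))).
  intros n; rewrite <- Cpartial_scal; apply Cpartial_ext; intros k.
  rewrite Cpower_nat by (apply Cexp_Clog_neg, Hx).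
  unfold kummer_coef.
  replace (RtoC x ^ k) with ((- RtoC 1) ^ k * (- RtoC x) ^ k)
    by (rewrite <- Cpow_mult_l; f_equal; ring).
  pose proof (pochhammer_nz (a + 1) k Ha1); pose proof (fact_RtoC_nz k).
  pose proof (pochhammer_nz a (S k) Ha) as HS.
  pose proof (pochhammer_shift a k) as Hsh; simpl in HS, Hsh.
  assert (a <> 0) by (intros H1; apply Ha; exists 0%nat; rewrite H1; simpl; ring).
  assert (a + RtoC (INR k) <> 0) by (intros E; apply HS; rewrite E; ring).
  replace (pochhammer a k) with (a * pochhammer (a + 1) k / (a + RtoC (INR k)))
    by (rewrite Hsh; field; assumption).
  field; auto.
Qed.

(** * The Whittaker function *)

Lemma nonpos_int_is_Cint (z : C) : is_nonpos_int z -> is_Cint z.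
Proof.
  intros [n ->]; exists (- Z.of_nat n)%Z.
  rewrite opp_IZR, <- INR_IZR_INZ, RtoC_opp; reflexivity.
Qed.

Lemma is_Cint_opp (z : C) : is_Cint z -> is_Cint (- z).
Proof. intros [k ->]; exists (- k)%Z; rewrite opp_IZR, RtoC_opp; reflexivity. Qed.

Lemma is_Cint_opp_iff (z : C) : is_Cint (- z) <-> is_Cint z.
Proof.
  split; [|apply is_Cint_opp]; intros H; apply is_Cint_opp in H.
  replace z with (- - z) by ring; exact H.
Qed.

Lemma is_Cint_minus_1 (z : C) : is_Cint (1 + z) -> is_Cint z.
Proof.
  intros [k Hk]; exists (k - 1)%Z; rewrite minus_IZR, RtoC_minus, <- Hk; ring.
Qed.

Lemma Cinv_inv (z : C) : / / z = z.
Proof.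
  destruct (excluded_middle_informative (z = 0)) as [->|Hz].
  - rewrite !Cinv_0; reflexivity.
  - field; exact Hz.
Qed.

(** In this form the dependence on [kappa] is through [RGamma] and [Kummer] only, both
    differentiable also where [Gamma (1/2 + nu - kappa)] has its pole. *)
Lemma WhittakerW_RGamma (kappa nu : C) (x : R) :
  ~ is_Cint (2 * nu) ->
  WhittakerW kappa nu x =
  RtoC (exp (- x / 2)) * Cpower (RtoC x) (nu + 1 / 2) *
    (Gamma (- (2 * nu)) * RGamma (1 / 2 + nu - kappa + - (2 * nu))
       * Kummer (1 / 2 + nu - kappa) (1 + 2 * nu) x
     + Gamma (2 * nu) * RGamma (1 / 2 + nu - kappa) * Cpower (RtoC x) (- (2 * nu))
       * Kummer (1 / 2 + nu - kappa + - (2 * nu)) (1 + - (2 * nu)) x).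
Proof.
  intros Hnu; unfold WhittakerW, TricomiU.
  destruct (excluded_middle_informative _) as [H|_].
  { exfalso; apply Hnu, is_Cint_minus_1, H. }
  unfold TricomiU_connection.
  replace (1 - (1 + 2 * nu)) with (- (2 * nu)) by ring.
  replace (1 / 2 + nu - kappa - (1 + 2 * nu) + 1) with
    (1 / 2 + nu - kappa + - (2 * nu)) by ring.
  replace (1 + 2 * nu - 1) with (2 * nu) by ring.
  replace (2 - (1 + 2 * nu)) with (1 + - (2 * nu)).
  2:{ replace (RtoC 2) with (RtoC 1 + RtoC 1) at 2
        by (rewrite <- RtoC_plus; f_equal; ring). ring. }
  assert (Hdiv : forall g z, g / Gamma z = g * RGamma z)
    by (intros g z; unfold Cdiv; rewrite Gamma_eq, Cinv_inv; reflexivity).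
  rewrite !Hdiv; reflexivity.
Qed.

Lemma Cpower_0 (z : C) : Cpower z 0 = 1.
Proof. unfold Cpower; rewrite Cmult_0_l; apply Cexp_0. Qed.

Lemma WhittakerW_opp (kappa nu : C) (x : R) :
  ~ is_Cint (2 * nu) -> WhittakerW kappa (- nu) x = WhittakerW kappa nu x.
Proof.
  intros Hnu.
  assert (Hnu' : ~ is_Cint (2 * - nu)).
  { replace (2 * - nu) with (- (2 * nu)) by ring; rewrite is_Cint_opp_iff; exact Hnu. }
  rewrite !WhittakerW_RGamma by assumption.
  replace (2 * - nu) with (- (2 * nu)) by ring.
  replace (- - (2 * nu)) with (2 * nu) by ring.
  replace (1 / 2 + - nu - kappa + 2 * nu) with (1 / 2 + nu - kappa) by ring.
  replace (1 / 2 + - nu - kappa) with (1 / 2 + nu - kappa + - (2 * nu)) by ring.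
  (* The prefactor for [- nu] is the one for [nu] times [x^(-2nu)]; absorbing this power
     interchanges the two summands. *)
  replace (- nu + 1 / 2) with ((nu + 1 / 2) + - (2 * nu)) by ring.
  assert (Hpq : Cpower (RtoC x) (- (2 * nu)) * Cpower (RtoC x) (2 * nu) = 1).
  { rewrite <- Cpower_plus; replace (- (2 * nu) + 2 * nu) with (RtoC 0) by ring.
    apply Cpower_0. }
  rewrite (Cpower_plus _ (nu + 1 / 2)).
  set (e := RtoC (exp (- x / 2))); set (A := Cpower (RtoC x) (nu + 1 / 2)).
  set (p := Cpower (RtoC x) (2 * nu)) in *.
  set (q := Cpower (RtoC x) (- (2 * nu))) in *.
  set (K1 := Kummer _ (1 + - (2 * nu)) x); set (K2 := Kummer _ (1 + 2 * nu) x).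
  set (r1 := RGamma (1 / 2 + nu - kappa)).
  set (r2 := RGamma (1 / 2 + nu - kappa + - (2 * nu))).
  transitivity (e * A * (Gamma (2 * nu) * r1 * q * K1
    + Gamma (- (2 * nu)) * r2 * (q * p) * K2)); [ring|rewrite Hpq; ring].
Qed.

Lemma is_Cderive_Gamma (z l : C) :
  ~ is_nonpos_int z -> is_Cderive RGamma z l ->
  is_Cderive Gamma z (l * - / (RGamma z * RGamma z)).
Proof.
  intros Hz Hl.
  apply (is_Cderive_ext (fun y => / RGamma y)); [intros y; symmetry; apply Gamma_eq|].
  apply (is_Cderive_comp Cinv); [apply is_Cderive_inv, RGamma_nz, Hz|exact Hl].
Qed.

Lemma digamma_RGamma (z l : C) :
  ~ is_nonpos_int z -> is_Cderive RGamma z l -> digamma z = - (l / RGamma z).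
Proof.
  intros Hz Hl; unfold digamma.
  rewrite (is_C_derive_unique _ _ _ (is_Cderive_Gamma z l Hz Hl)), Gamma_eq.
  pose proof (RGamma_nz z Hz).
  unfold Cdiv at 1; rewrite Cinv_inv; field; assumption.
Qed.

Lemma Cpower_half (x : R) : (0 < x)%R -> Cpower (RtoC x) (1 / 2) = RtoC (sqrt x).
Proof.
  intros Hx; unfold Cpower; rewrite Clog_pos, <- RtoC_div, <- RtoC_mult by lra.
  rewrite Cexp_RtoC; f_equal.
  rewrite <- Rpower_sqrt by exact Hx; unfold Rpower; f_equal; field.
Qed.

Theorem theorem3 (mu : C) (x : R) :
  ~ is_Cint (2 * mu) -> (0 < x)%R ->
  forall nu : C, nu = mu \/ nu = - mu ->
  is_derive (K := C_AbsRing) (V := C_NormedModule)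
    (fun kappa : C => WhittakerW kappa nu x) (mu + 1 / 2)
    (RtoC (sqrt x) * RtoC (exp (- x / 2)) *
      (Cpower (RtoC x) mu *
         (digamma (- (2 * mu))
          - RtoC x / (2 * mu + 1)
            * pFq (RtoC 1 :: RtoC 1 :: nil) (2 * mu + 2 :: RtoC 2 :: nil) (RtoC x))
       + Gamma (2 * mu + 1) * Cpower (RtoC x) (- mu)
         * Cpower (- RtoC x) (2 * mu) * lower_gamma (- (2 * mu)) (- RtoC x))).
Proof.
  intros Hmu Hx nu Hnu.
  set (c := 2 * mu) in *.
  assert (Hc : ~ is_nonpos_int c) by (intros H; apply Hmu, nonpos_int_is_Cint, H).
  assert (Hmc : ~ is_nonpos_int (- c)).
  { intros H; apply Hmu, is_Cint_opp_iff, nonpos_int_is_Cint, H. }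
  assert (Hc1 : ~ is_nonpos_int (1 + c)).
  { intros H; apply Hmu, is_Cint_minus_1, nonpos_int_is_Cint, H. }
  assert (Hmc1 : ~ is_nonpos_int (1 + - c)).
  { intros H; apply Hmu, is_Cint_opp_iff, is_Cint_minus_1, nonpos_int_is_Cint, H. }
  destruct (ex_Cderive_RGamma (- c)) as [r [_ Hr]].
  pose proof (is_Cderive_Kummer_0 (1 + c) x Hc1 Hx) as Hk.
  set (k := RtoC x / (1 + c) * _) in Hk.
  (* The product rule requires this derivative to exist; it will be multiplied by [RGamma 0 = 0]. *)
  destruct (ex_Cderive_Kummer (- c) (1 + - c) x Hmc1 Hx) as [m [_ Hm]].
  pose proof (is_Cderive_shift (- c) 0) as Hshift.
  assert (HA : is_Cderive (fun a => Gamma (- c) * (RGamma (a + - c) * Kummer a (1 + c) x)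
      + Gamma c * Cpower (RtoC x) (- c) * (RGamma a * Kummer (a + - c) (1 + - c) x)) 0
      (Gamma (- c) * (1 * r * Kummer 0 (1 + c) x + RGamma (0 + - c) * k)
       + Gamma c * Cpower (RtoC x) (- c)
         * (1 * Kummer (0 + - c) (1 + - c) x + RGamma 0 * (1 * m)))).
  { apply is_Cderive_plus; apply is_Cderive_scal.
    - apply (is_Cderive_mult (fun a => RGamma (a + - c))); [|exact Hk].
      apply (is_Cderive_comp RGamma); [rewrite Cplus_0_l; exact Hr|exact Hshift].
    - apply (is_Cderive_mult RGamma); [exact is_Cderive_RGamma_0|].
      apply (is_Cderive_comp (fun a => Kummer a (1 + - c) x));
        [rewrite Cplus_0_l; exact Hm|exact Hshift]. }
  (* The inner derivative -1 supplies the sign that turns [r / RGamma (- c)] into [digamma (- c)],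
     the logarithmic derivative of the reciprocal. *)
  assert (Haff : is_Cderive (fun kappa => 1 / 2 + mu + - (1) * kappa) (mu + 1 / 2) (- (1))).
  { pose proof (is_Cderive_plus _ _ _ _ _ (is_Cderive_const (1 / 2 + mu) (mu + 1 / 2))
      (is_Cderive_linear (- (1)) (mu + 1 / 2))) as H.
    rewrite Cplus_0_l in H; exact H. }
  (* Only the base point is rewritten; the zeros in the derivative value are simplified at the
     end. *)
  replace (RtoC 0) with (1 / 2 + mu + - (1) * (mu + 1 / 2)) in HA at 1 by ring.
  pose proof (is_Cderive_scal
    (RtoC (exp (- x / 2)) * Cpower (RtoC x) (mu + 1 / 2)) _ _ _
    (is_Cderive_comp _ (fun kappa => 1 / 2 + mu + - (1) * kappa) _ _ _ HA Haff)) as HW.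
  match goal with |- is_derive _ _ ?v =>
    match type of HW with is_Cderive _ _ ?w => replace v with w end end.
  - refine (is_Cderive_ext _ _ _ _ _ HW); intros kappa.
    replace (WhittakerW kappa nu x) with (WhittakerW kappa mu x)
      by (destruct Hnu as [->| ->]; [|symmetry; apply WhittakerW_opp]; auto).
    rewrite WhittakerW_RGamma by exact Hmu; fold c.
    replace (1 / 2 + mu + - (1) * kappa) with (1 / 2 + mu - kappa) by ring.
    ring.
  - rewrite Cplus_0_l, RGamma_0, Kummer_0 by assumption.
    rewrite (digamma_RGamma (- c) r Hmc Hr).
    rewrite lower_gamma_Kummer by assumption.
    replace (- c + 1) with (1 + - c) by ring.
    unfold k; replace (1 + c + 1) with (c + 2).
    2:{ replace (RtoC 2) with (RtoC 1 + RtoC 1)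
          by (rewrite <- RtoC_plus; f_equal; ring). ring. }
    replace (c + 1) with (1 + c) by ring.
    (* The second solution contributes [- Gamma c], that is [- Gamma (c+1) / c]; the same factor
       [/ (- c)] comes from the incomplete gamma function. *)
    rewrite !Gamma_eq, <- (RGamma_succ c), (Cplus_comm c 1).
    rewrite Cpower_plus, Cpower_half by exact Hx.
    replace (Cpower (RtoC x) (- mu)) with (Cpower (RtoC x) mu * Cpower (RtoC x) (- c)).
    2:{ rewrite <- Cpower_plus; f_equal; unfold c; ring. }
    (* The branch of [(-x)^c] in the statement is undone by the power [(-x)^(-c)] in the incomplete
       gamma function. *)
    assert (Hp : Cpower (- RtoC x) c * Cpower (- RtoC x) (- c) = 1).
    { rewrite <- Cpower_plus, Cplus_opp_r; apply Cpower_0. }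
    pose proof (RGamma_nz _ Hmc); pose proof (RGamma_nz _ Hc1).
    assert (Hc0 : c <> 0)
      by (intros H1; apply Hc; exists 0%nat; rewrite H1; simpl; ring).
    assert (1 + c <> 0)
      by (intros H1; apply Hc1; exists 0%nat; rewrite H1; simpl; ring).
    set (P := Cpower (- RtoC x) c) in *; set (Q := Cpower (- RtoC x) (- c)) in *.
    set (F := pFq _ _ _); set (K := Kummer _ _ _).
    transitivity (RtoC (sqrt x) * RtoC (exp (- x / 2)) *
      (Cpower (RtoC x) mu * (- (r / RGamma (- c)) - RtoC x / (1 + c) * F)
       + / RGamma (1 + c) * (Cpower (RtoC x) mu * Cpower (RtoC x) (- c))
         * ((P * Q) / (- c) * K))).
    + rewrite Hp; field; auto.
    + field; auto.
Qed.
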